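(* Let $\psi$ be a Minkowski norm and $\phi$ a weak Minkowski norm on $\mathbb{R}^n$, and set $\Omega:=\{x\in\mathbb{R}^n:\phi(x)<1\}$. Define $F:\Omega\times\mathbb{R}^n\to\mathbb{R}$ by $$F(x,y):=\psi(y+xP(x,y))\,\{1+x^kP_{y^k}(x,y)\},$$ where $P=P(x,y)$ is the unique solution of $P=\phi(y+xP)$, $(x,y)\in\Omega\times\mathbb{R}^n$, and let $\mathscr O:=\{x\in\Omega:F(x,\cdot)\text{ is a Minkowski norm}\}$. Let $U$ be a convex connected component of $\mathscr O$. Then the following hold: (a) for any smooth point $x\in\partial U\cap\Omega$ and any vector $y$ not tangent to $\partial U$ at $x$, the matrix $([F^2]_{y^iy^j}(x,y))$ is positive definite; (b) for any smooth point $x\in\partial U\cap\Omega$, there exists a nonzero vector $y$ tangent to $\partial U$ at $x$ such that $([F^2]_{y^iy^j}(x,y))$ has a zero eigenvalue. Moreover, the corresponding eigenvector $\theta=(\theta^i)$ is not parallel to $y$ and satisfies $$F_{y^i}(x,y)\theta^i=0,\qquad F_{y^iy^j}(x,y)\theta^i\theta^j=0.$$ If, in addition, the vector $x$ is not tangent to $\partial U$ at the point $x$, then for all sufficiently small $|t|\ne0$, $$F_{y^iy^j}(x,y+tx)\theta^i\theta^j>0.$$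
   Context: Throughout $n\ge2$; subscripts $y^i$ denote partial derivatives, repeated indices are summed. A pseudo-norm on $\mathbb{R}^n$ is a function $\varphi\ge0$ vanishing only at $\mathbf 0$, with $\varphi(\alpha y)=\alpha\varphi(y)$ for $\alpha>0$ and $\varphi(y_1+y_2)\le\varphi(y_1)+\varphi(y_2)$. It is a weak Minkowski norm if it is smooth on $\mathbb{R}^n\setminus\{\mathbf 0\}$ and equality in the triangle inequality holds only if $\alpha_1y_1=\alpha_2y_2$ for some $\alpha_1,\alpha_2\ge0$, $\alpha_1+\alpha_2>0$. It is a Minkowski norm if moreover $([\varphi^2]_{y^iy^j}(y))$ is positive definite for all $y\ne\mathbf 0$. A smooth point of $\partial U$ is a point at which the boundary of the convex set $U$ has a (unique) tangent hyperplane; a vector is tangent to $\partial U$ at $x$ if it lies in the direction space of that hyperplane. *)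

(* Defs.v *)
From mathcomp Require Import all_boot all_order all_algebra.
From mathcomp Require Import all_classical all_reals all_analysis.
From mathcomp Require Import lra.
Set Implicit Arguments.
Unset Strict Implicit.
Unset Printing Implicit Defensive.
Import Order.TTheory GRing.Theory Num.Theory.
Import numFieldNormedType.Exports.
Local Open Scope classical_set_scope.
Local Open Scope ring_scope.

(* Points and vectors of R^n are row vectors; the ambient norm on 'rV[R]_n is
   the sup norm, which induces the usual topology. *)

Section Calculus.
Variables (R : realType) (n : nat).
Implicit Types (f : 'rV[R]_n -> R) (x y v : 'rV[R]_n).

Definition partial (i : 'I_n) f : 'rV[R]_n -> R :=
  fun y => 'D_(delta_mx 0 i) f y.

Definition smooth_on (A : set 'rV[R]_n) f : Prop :=
  forall (s : seq 'I_n) y, A y ->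
    {for y, continuous (foldr partial f s)} /\
    forall i, derivable (foldr partial f s) y (delta_mx 0 i).

(* The entry (i, j) is f_{y^i y^j}: differentiate along y^i, then along y^j. *)
Definition hessian f y : 'M[R]_n :=
  \matrix_(i, j) partial j (partial i f) y.

(* Symmetry is not required: it is automatic for Hessians of C^2 functions. *)
Definition posdef (A : 'M[R]_n) : Prop :=
  forall v, v != 0 -> 0 < \sum_i \sum_j A i j * v 0 i * v 0 j.

End Calculus.

Section MinkowskiNorms.
Variables (R : realType) (n : nat).
Implicit Types (phi psi : 'rV[R]_n -> R).

Record pseudo_norm phi : Prop := PseudoNorm {
  pn_ge0 : forall y, 0 <= phi y ;
  pn_eq0 : forall y, phi y = 0 <-> y = 0 ;
  pn_homo : forall (a : R) y, 0 < a -> phi (a *: y) = a * phi y ;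
  pn_triangle : forall y1 y2, phi (y1 + y2) <= phi y1 + phi y2
}.

Record weak_minkowski_norm phi : Prop := WeakMinkowskiNorm {
  wm_pseudo : pseudo_norm phi ;
  wm_smooth : smooth_on [set y | y != 0] phi ;
  wm_strict : forall y1 y2, phi (y1 + y2) = phi y1 + phi y2 ->
    exists a1 a2 : R,
      [/\ 0 <= a1, 0 <= a2, 0 < a1 + a2 & a1 *: y1 = a2 *: y2]
}.

Record minkowski_norm phi : Prop := MinkowskiNorm {
  mk_weak : weak_minkowski_norm phi ;
  mk_posdef : forall y, y != 0 -> posdef (hessian (fun z => phi z ^+ 2) y)
}.

End MinkowskiNorms.

Section ConvexBoundary.
Variables (R : realType) (n : nat).
Implicit Types (U : set 'rV[R]_n) (x v : 'rV[R]_n).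

Definition boundary U : set 'rV[R]_n := closure U `\` U°.

(* H is the direction space of a hyperplane supporting U at x, namely the
   hyperplane x + H with normal covector nu. *)
Definition supporting_direction U x (H : set 'rV[R]_n) : Prop :=
  exists nu : 'rV[R]_n, [/\ nu != 0,
    forall u, U u -> \sum_i nu 0 i * (u 0 i - x 0 i) <= 0 &
    H = [set v | \sum_i nu 0 i * v 0 i = 0]].

(* For a convex set, a tangent hyperplane of the boundary at x is a unique
   supporting hyperplane at x. *)
Definition smooth_boundary_point U x : Prop :=
  boundary U x /\ exists! H, supporting_direction U x H.

(* Only meant at smooth boundary points, where H is unique. *)
Definition tangent U x v : Prop :=
  exists2 H, supporting_direction U x H & H v.

Definition is_component (U A : set 'rV[R]_n) : Prop :=
  exists2 x, A x & U = connected_component A x.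

End ConvexBoundary.

Section Metric.
Variables (R : realType) (n : nat).
Variables (psi phi : 'rV[R]_n -> R).
Implicit Types (x y : 'rV[R]_n).

Definition Omega : set 'rV[R]_n := [set x | phi x < 1].

(* A solution p of p = phi (y + p x); for x in Omega it exists and is unique,
   see exists_unique_Psol below. *)
Definition Psol x y : R := xget 0 [set p | p = phi (y + p *: x)].

(* Psol x is not differentiable at y = 0, where the first factor vanishes, so
   that Fmetric x 0 = 0 whatever the value of the second one. *)
Definition Fmetric x y : R :=
  psi (y + Psol x y *: x) * (1 + \sum_k x 0 k * partial k (Psol x) y).

Definition Oset : set 'rV[R]_n :=
  [set x | Omega x /\ minkowski_norm (Fmetric x)].

Lemma exists_unique_Psol x y : pseudo_norm phi -> Omega x ->
  exists! p, p = phi (y + p *: x).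
Proof.
rewrite /Omega /= => phiP x1.
have tri (p q : R) : q <= p ->
    phi (y + p *: x) <= phi (y + q *: x) + (p - q) * phi x /\
    phi (y + q *: x) <= phi (y + p *: x) + (p - q) * phi (- x).
  rewrite le_eqVlt => /predU1P[->|qp]; first by rewrite subrr !mul0r !addr0.
  have pq0 : 0 < p - q by rewrite subr_gt0.
  rewrite -!(pn_homo phiP) //; split.
    apply: le_trans (pn_triangle phiP _ _).
    by rewrite -addrA -scalerDl (addrC q) subrK.
  apply: le_trans (pn_triangle phiP _ _).
  by rewrite -addrA scalerN -scalerBl opprB (addrC p) subrK.
have [x0 Nx0 y0] : [/\ 0 <= phi x, 0 <= phi (- x) & 0 <= phi y].
  by split; exact: pn_ge0.
pose g (p : R) : R := p - phi (y + p *: x).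
pose M := phi y / (1 - phi x).
have ME : M * (1 - phi x) = phi y by rewrite divfK // subr_eq0 gt_eqF.
have M0 : 0 <= M by rewrite divr_ge0 // subr_ge0 ltW.
have cg : continuous g.
  move=> p; apply: continuousB; first exact: cvg_id.
  have K0 : 0 < phi x + phi (- x) + 1 by lra.
  apply/cvgrPdist_le => e e0; near=> q.
  have dpq : `|p - q| <= e / (phi x + phi (- x) + 1).
    near: q.
    exact: (@cvgr_dist_le _ _ _ (nbhs p) _ id p cvg_id _ (divr_gt0 e0 K0)).
  have /le_trans-> // : `|phi (y + p *: x) - phi (y + q *: x)|
      <= `|p - q| * (phi x + phi (- x) + 1).
    have [pq|qp] := leP p q.
      by have [? ?] := tri _ _ pq; rewrite ler_norml distrC ger0_norm; nra.
    have [? ?] := tri _ _ (ltW qp).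
    by rewrite ler_norml ger0_norm ?subr_ge0 ?ltW //; nra.
  by rewrite -ler_pdivlMr.
have gM : 0 <= g M.
  have [] := tri _ _ M0; rewrite scale0r addr0 subr0 => + _.
  by rewrite /g; nra.
have g0 : g 0 <= 0 by rewrite /g scale0r addr0 sub0r oppr_le0.
have [||p _ gp] := @IVT R g 0 M 0 M0.
- exact/continuous_subspaceT.
- by rewrite minEle maxEle (le_trans g0 gM) g0 gM.
have pE : p = phi (y + p *: x) by apply/eqP; rewrite -subr_eq0 -/(g p) gp.
exists p; split=> // q qE.
have aux (r s : R) : r = phi (y + r *: x) -> s = phi (y + s *: x) ->
    r <= s -> r = s.
  by move=> rE sE rs; have [+ _] := tri _ _ rs; rewrite -rE -sE; nra.
by have [/aux->|/ltW/aux->] := leP p q.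
Unshelve. all: by end_near.
Qed.

Lemma PsolP x y : pseudo_norm phi -> Omega x ->
  Psol x y = phi (y + Psol x y *: x).
Proof.
move=> phiP /(exists_unique_Psol y phiP)[p [pE _]].
by have /(@xgetPex _ 0) : exists q, [set p | p = phi (y + p *: x)] q by exists p.
Qed.

End Metric.

(* Main.v *)
From HB Require Import structures.
Require Import Defs.
From mathcomp Require Import all_boot all_order all_algebra.
From mathcomp Require Import all_classical all_reals all_analysis.
From mathcomp Require Import ring lra.
Set Implicit Arguments.
Unset Strict Implicit.
Unset Printing Implicit Defensive.
Import Order.TTheory GRing.Theory Num.Theory.
Import numFieldNormedType.Exports.
Local Open Scope classical_set_scope.
Local Open Scope ring_scope.

(** With [xi = y + P x] one has [F(x, y) = psi(xi) / (1 - phi_x(xi))], and a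
    direct computation gives [F_vv(x, y)] as an expression [gform] in [x], [xi]
    and the derivative [V] of [xi] along [v].  Two facts follow.  First, moving
    the base point [x] along [y] does not change [F_vv(x, y)].  Second, after
    normalising [xi] and [V] to the unit sphere, compactness shows that [Oset]
    is open, and that the Hessian of [F^2] is semidefinite on its closure.

    If [y] is not tangent to the boundary of [U] at [x], the line [x + t y]
    meets the open convex set [U] (otherwise a hyperplane containing the line
    supports [U]), so the first fact yields (a).  A boundary point is not in [Oset], and
    positive definiteness off the origin would give the triangle inequality;
    hence the Hessian degenerates at some [y], which is tangent by (a), and
    semidefiniteness turns this into a zero eigenvalue. *)

(** * Differential calculus on row vectors *)

(** [smooth_on] speaks only of iterated partial derivatives, so total differentiability, the chain
    rule and the symmetry of second derivatives have to be derived from it. [P] is given implicitly: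
    a Lipschitz estimate makes it differentiable, and since the derivative of a function of [xi] is
    again a function of [xi], smoothness of all orders follows by induction, without an implicit
    function theorem. The variables [z = xi y] and [V] range over all nonzero vectors, a set
    independent of [x], and [gform] involves [x] only through derivatives of [psi] and [phi] at [z].
    Joint continuity in [x], [z], [V] can then be read off, which is not so for [F(x, y)]. The
    invariance of [F_vv] along [x + t y] integrates [y^k F_{x^k y^i y^j} = 0], a consequence of
    Hamel's equation for projectively flat metrics; here it is checked on [gform], with no
    derivative in [x]. The Hessian of [F^2] itself need not be invariant, so its definiteness is
    rephrased in [posdef_sqrP] as [F_vv > 0] for all [v] not parallel to [y]. *)

Section RowVectors.
Variables (R : realType) (n : nat).
Implicit Types (x y h : 'rV[R]_n).

Lemma norm_coord x j : `|x 0 j| <= `|x|.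
Proof.
rewrite [X in _ <= X]mx_normrE.
exact: (le_bigmax (0 : R) (fun ij => `|x ij.1 ij.2|) (0, j)).
Qed.

Lemma norm_row_le x e : 0 <= e -> (forall j, `|x 0 j| <= e) -> `|x| <= e.
Proof.
move=> e0 xe; rewrite /Num.norm /= mx_normrE.
by apply/bigmax_leP; split => //= -[i j] _ /=; rewrite ord1.
Qed.

(** Consecutive truncations differ along a single axis, so the increment of [f] from [y] to [y + h]
    telescopes into increments along coordinate axes. *)
Definition row_take (k : nat) h : 'rV[R]_n :=
  \row_j (if (j < k)%N then h 0 j else 0).

Lemma row_take0 h : row_take 0 h = 0.
Proof. by apply/rowP => j; rewrite !mxE. Qed.

Lemma row_take_full h : row_take n h = h.
Proof. by apply/rowP => j; rewrite !mxE ltn_ord. Qed.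

Lemma row_takeS (k : 'I_n) h :
  row_take k.+1 h = row_take k h + h 0 k *: delta_mx 0 k.
Proof.
apply/rowP => j; rewrite !mxE eqxx /= ltnS leq_eqVlt.
have [->|jk] := eqVneq j k; first by rewrite eqxx ltnn /= mulr1 add0r.
by move: jk; rewrite -val_eqE /= => /negbTE ->; rewrite mulr0 addr0.
Qed.

Lemma norm_row_take_segment (k : 'I_n) h t : 0 <= t <= 1 ->
  `|row_take k h + t *: (h 0 k *: delta_mx 0 k)| <= `|h|.
Proof.
move=> /andP[t0 t1]; apply: norm_row_le => // j; rewrite !mxE eqxx /=.
have [->|jk] := eqVneq j k; last first.
  rewrite !mulr0 addr0; case: ifP => _; last by rewrite normr0.
  exact: norm_coord.
rewrite ltnn mulr1 add0r normrM ger0_norm//.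
by rewrite (le_trans _ (norm_coord h k))// ler_piMl.
Qed.

End RowVectors.

Section Lines.
Variables (R : realType) (V : normedModType R).
Implicit Types (f : V -> R) (y v : V).

Lemma is_derive_line f y v (t : R) : derivable f (y + t *: v) v ->
  is_derive t 1 (fun s : R => f (y + s *: v)) ('D_v f (y + t *: v)).
Proof.
move=> df; have E : (fun h : R => h^-1 *:
    (((fun s : R => f (y + s *: v)) \o shift t) (h *: 1) - f (y + t *: v)))
  = (fun h : R => h^-1 *: ((f \o shift (y + t *: v)) (h *: v) - f (y + t *:
    v))).
  apply/funext => h /=; congr (_ *: (f _ - _)).
  by rewrite [h *: 1]mulr1 scalerDl addrCA.
by split; rewrite ?/derivable ?/derive E.
Qed.

Lemma MVT01 (g dg : R -> R) :
  (forall t : R, 0 <= t <= 1 -> is_derive t 1 g (dg t)) ->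
  exists2 c : R, 0 < c < 1 & g 1 - g 0 = dg c.
Proof.
move=> gd; have gc : {within `[0, 1], continuous g}.
  by apply: derivable_within_continuous => t; rewrite in_itv /= => /gd[].
have gd' (t : R) : t \in `]0, 1[%R -> is_derive t 1 g (dg t).
  by rewrite in_itv /= => /andP[t0 t1]; apply: gd; rewrite !ltW.
have [c c01 E] := MVT (ltr01 : (0 : R) < 1) gd' gc.
exists c; first by move: c01; rewrite in_itv.
by move: E; rewrite subr0 mulr1.
Qed.

Lemma line_MVT f y v : (forall t : R, 0 <= t <= 1 ->
  derivable f (y + t *: v) v) ->
  exists2 c : R, 0 < c < 1 & f (y + v) - f y = 'D_v f (y + c *: v).
Proof.
move=> df; have [t t01|c c01] := @MVT01 (fun s => f (y + s *: v))
  (fun s => 'D_v f (y + s *: v)); first by apply: is_derive_line; exact: df.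
by rewrite scale1r scale0r addr0; exists c.
Qed.

End Lines.

(** * Directional derivatives and total differentiability *)

Section ContinuouslyDifferentiable.
Variables (R : realType) (n : nat).
Implicit Types (f : 'rV[R]_n -> R) (x y v : 'rV[R]_n).

(** A sum of partial derivatives rather than ['D_v f]: linearity in [v] is then immediate, and
    [dirE] recovers the derivative where [f] is smooth. *)
Definition dir v f : 'rV[R]_n -> R := fun y => \sum_i v 0 i * partial i f y.

Lemma dir_is_linear f y : linear (fun v => dir v f y : R).
Proof.
move=> a u v; rewrite /dir scaler_sumr -big_split; apply: eq_bigr => i _ /=.
by rewrite !mxE mulrDl -mulrA.
Qed.

Lemma dir_lipschitz f y : exists2 C : R, 0 <= C &
  forall v, `|dir v f y| <= C * `|v|.
Proof.
exists (\sum_i `|partial i f y|); first by apply: sumr_ge0.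
move=> v; apply: le_trans (ler_norm_sum _ _ _) _.
rewrite mulr_suml; apply: ler_sum => i _; rewrite normrM mulrC.
by rewrite ler_wpM2l ?norm_coord.
Qed.

Lemma derivableZv f y v (c : R) : derivable f y v -> derivable f y (c *: v).
Proof.
move=> df; have [->|c0] := eqVneq c 0; first by rewrite scale0r;
  exact: derivable0.
have dg : is_derive (0:R) 1 (fun s : R => f (y + s *: v)) ('D_v f (y + 0 *: v)).
  by apply: is_derive_line; rewrite scale0r addr0.
have d0 : differentiable (fun s : R => f (y + s *: v)) 0.
  by apply/derivable1_diffP; case: dg.
have /diff_derivable : differentiable (fun s : R => f (y + s *: v)) 0 by [].
move/(_ c); rewrite /derivable.
set F1 := (X in cvg (X @ _) -> _); set F2 := (X in _ -> cvg (X @ _)).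
suff -> : F1 = F2 by [].
apply/funext => h; rewrite /F1 /F2 /=; congr (_ *: (f _ - f _)).
  by rewrite addr0 scalerA addrC.
by rewrite scale0r addr0.
Qed.

Lemma derive_scalev f y v (c : R) : derivable f y v ->
  'D_(c *: v) f y = c * 'D_v f y.
Proof.
move=> df; have dg : is_derive (0:R) 1 (fun s : R => f (y + s *: v)) ('D_v f y).
  by have := @is_derive_line _ _ f y v 0; rewrite scale0r addr0; apply.
have d0 : differentiable (fun s : R => f (y + s *: v)) 0.
  by apply/derivable1_diffP; case: dg.
have -> : 'D_(c *: v) f y = 'D_c (fun s : R => f (y + s *: v)) 0.
  have E : (fun h : R => h^-1 *: ((f \o shift y) (h *: (c *: v)) - f y))
    = (fun h : R => h^-1 *: (((fun s : R => f (y + s *: v)) \o shift 0) (h *: c)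
        - (fun s : R => f (y + s *: v)) 0)).
    apply/funext => h /=; congr (_ *: (f _ - f _)).
      by rewrite addr0 scalerA addrC.
    by rewrite scale0r addr0.
  by rewrite /derive E.
rewrite deriveE// -[X in 'd _ _ X]mulr1 [LHS]linearZ /= -deriveE//.
by rewrite derive_val.
Qed.

(** The increment telescopes over [row_take]; the mean value theorem turns each term into a partial
    derivative at an intermediate point, which in the sup norm stays within [|h|] of [y]. *)
Lemma C1_differentiable f y :
  (forall i, \forall z \near y, derivable f z (delta_mx 0 i)) ->
  (forall i, {for y, continuous (partial i f)}) ->
  'd f y = (fun v => dir v f y) :> ('rV[R]_n -> R) /\ differentiable f y.
Proof.
move=> dfi cfi.
pose L := GRing.isLinear.Build _ _ _ _ _ (dir_is_linear f y).
pose Ll : {linear 'rV[R]_n -> R} := HB.pack (fun v => dir v f y : R) L.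
have cL : continuous Ll.
  have [C C0 HC] := dir_lipschitz f y.
  apply/linear_bounded_continuous; exists C; split; first exact: num_real.
  move=> M CM; near=> z; apply: le_trans (HC z) (le_trans _ (ltW CM)).
  by rewrite ler_piMr//; near: z; exact: nbhs0_le.
have E : f \o shift y = cst (f y) + Ll +o_ (0 : 'rV[R]_n) id.
  apply/eqaddoP => e e0.
  (* Each of the [n] terms contributes at most [e / (n + 1) * |h|]; the [+ 1] covers [n = 0]. *)
  have e1 : 0 < e / (n%:R + 1) by rewrite divr_gt0// ltr_wpDl// ler0n.
  have near_all : \forall z \near y, forall i : 'I_n,
    derivable f z (delta_mx 0 i) /\
      `|partial i f z - partial i f y| <= e / (n%:R + 1).
    apply: (@filter_forall _ 'I_n (fun i z => derivable f z (delta_mx 0 i) /\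
      `|partial i f z - partial i f y| <= e / (n%:R + 1)) (nbhs y) _) => i.
    have di := dfi i; near=> z; split; first by near: z.
    rewrite distrC; near: z; exact: (@cvgr_dist_le _ _ _ _ _ _ _ (cfi i) _ e1).
  have /nbhs_ballP[d /= d0 Hd] := near_all.
  have near_d : \forall h \near (0 : 'rV[R]_n), `|h| < d by exact: nbhs0_lt.
  near=> h.
  have hd : `|h| < d.
    by near: h; exact: near_d.
  have Hz (k : 'I_n) (t : R) : 0 <= t <= 1 -> forall i,
      derivable f (y + row_take k h + t *: (h 0 k *: delta_mx 0 k)) (delta_mx 0
        i) /\
      `|partial i f (y + row_take k h + t *: (h 0 k *: delta_mx 0 k)) - partial
        i f y| <= e / (n%:R + 1).
    move=> t01; apply: Hd; rewrite -ball_normE /= -addrA opprD addNKr normrN.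
    exact: le_lt_trans (norm_row_take_segment k h t01) hd.
  rewrite !fctE /=.
  have -> : (f (h + y) - (f y + dir h f y) : R) =
    \sum_(k < n) (f (y + row_take k.+1 h) - f (y + row_take k h) - h 0 k *
      partial k f y).
    rewrite sumrB opprD addrA; congr (_ - _).
    rewrite -(big_mkord xpredT (fun k => f (y + row_take k.+1 h) - f (y +
      row_take k h))).
    by rewrite telescope_sumr// row_take0 row_take_full addr0 [h + y]addrC.
  apply: le_trans (ler_norm_sum _ _ _) _.
  have step (k : 'I_n) : `|f (y + row_take k.+1 h) - f (y + row_take k h)
      - h 0 k * partial k f y| <= e / (n%:R + 1) * `|h|.
    rewrite row_takeS addrA.
    have [t t01|c c01 ->] := @line_MVT _ _ f (y + row_take k h) (h 0 k *:
      delta_mx 0 k).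
      by apply: derivableZv; have [] := Hz k _ t01 k.
    have c01' : 0 <= c <= 1 by case/andP: c01 => ? ?; rewrite !ltW.
    have [dk bk] := Hz k _ c01' k.
    rewrite derive_scalev// -mulrBr normrM mulrC ler_pM//.
    exact: norm_coord.
  apply: le_trans (ler_sum _ (fun k _ => step k)) _.
  rewrite sumr_const card_ord -[leLHS]mulr_natr mulrAC ler_wpM2r//.
  rewrite mulrAC ler_pdivrMr ?ltr_wpDl ?ler0n//.
  by rewrite ler_wpM2l ?(ltW e0)// lerDl.
have dE : 'd f y = Ll :> (_ -> _) by apply: diff_unique.
split; first by rewrite dE.
by apply/diff_locallyP; rewrite dE; split.
Unshelve. all: by end_near. Qed.

End ContinuouslyDifferentiable.

(** * Smooth functions on an open set *)

Section SmoothFunctions.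
Variables (R : realType) (n : nat) (A : set 'rV[R]_n).
Hypothesis Aopen : open A.
Implicit Types (f g : 'rV[R]_n -> R) (x y v : 'rV[R]_n).

(** [smooth_on] quantifies over sequences of partial derivatives, along which products and inverses
    admit no direct induction; counting the order supplies one. *)
Fixpoint Ck (k : nat) f : Prop :=
  (forall y, A y -> {for y, continuous f}) /\
  if k is k'.+1 then
    (forall y, A y -> forall i, derivable f y (delta_mx 0 i)) /\
    forall i, Ck k' (partial i f)
  else True.

Lemma Ck_continuous k f y : Ck k f -> A y -> {for y, continuous f}.
Proof. by case: k => [|k] [cf _]; exact: cf. Qed.

Lemma CkW k f : Ck k.+1 f -> Ck k f.
Proof.
elim: k f => [|k IH] f [cf [df pf]]; first by split.
by split => //; split => // i; exact: IH.
Qed.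

Lemma smooth_on_partial f i : smooth_on A f -> smooth_on A (partial i f).
Proof. by move=> sf s y Ay; rewrite -foldr_rcons; exact: sf. Qed.

Lemma smooth_onP f : smooth_on A f <-> forall k, Ck k f.
Proof.
split=> [sf k|cf].
  elim: k f sf => [|k IH] f sf; first by split=> // y Ay; case: (sf [::] y Ay).
  split; first by move=> y Ay; case: (sf [::] y Ay).
  split=> [y Ay i|i]; first by case: (sf [::] y Ay).
  by apply: IH; exact: smooth_on_partial.
move=> s; elim/last_ind: s f cf => [|s i IH] f cf y Ay.
  split; first exact: Ck_continuous (cf 0%N) Ay.
  by move=> i; case: (cf 1%N) => _ [df _]; exact: df.
rewrite foldr_rcons; apply: IH => // k.
by case: (cf k.+1) => _ [_]; exact.
Qed.

Lemma partial_eq f g i y : A y -> (forall z, A z -> f z = g z) ->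
  partial i f y = partial i g y.
Proof.
move=> Ay fg; apply: near_eq_derive; near=> z; apply: fg.
by near: z; exact: open_nbhs_nbhs.
Unshelve. all: by end_near. Qed.

Lemma Ck_eq k f g : (forall z, A z -> f z = g z) -> Ck k f -> Ck k g.
Proof.
have cE f' g' : (forall z, A z -> f' z = g' z) ->
    (forall y, A y -> {for y, continuous f'}) ->
    (forall y, A y -> {for y, continuous g'}).
  move=> fg cf y Ay; rewrite /prop_for /continuous_at -(fg y Ay).
  apply: cvg_trans (cf y Ay); apply: (@near_eq_cvg _ _ (nbhs y)); near=> z.
  by apply: fg; near: z; exact: open_nbhs_nbhs.
elim: k f g => [|k IH] f g fg [cf df]; first by split => //; exact: cE cf.
split; first exact: cE cf.
case: df => df pf; split=> [y Ay i|i].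
  apply: near_eq_derivable (df y Ay i); near=> z.
  by apply: fg; near: z; exact: open_nbhs_nbhs.
by apply: IH (pf i) => z Az; exact: partial_eq.
Unshelve. all: by end_near. Qed.

Lemma smooth_on_eq f g : (forall z, A z -> f z = g z) ->
  smooth_on A f -> smooth_on A g.
Proof. by move=> fg /smooth_onP cf; apply/smooth_onP => k;
  exact: Ck_eq fg _. Qed.

Lemma partial_cst (c : R) (i : 'I_n) :
  partial i (fun=> c) = (fun=> 0) :> ('rV[R]_n -> R).
Proof. by apply/funext => y; rewrite /partial derive_cst. Qed.

Lemma Ck_cst k (c : R) : Ck k (fun=> c).
Proof.
elim: k c => [|k IH] c; first by split => // y _; exact: cst_continuous.
split; first by move=> y _; exact: cst_continuous.
by split=> [y _ i|i]; [exact: derivable_cst|rewrite partial_cst].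
Qed.

Lemma CkD k f g : Ck k f -> Ck k g -> Ck k (fun y => f y + g y).
Proof.
elim: k f g => [|k IH] f g [cf df] [cg dg].
  by split=> // y Ay; apply: continuousD; [exact: cf|exact: cg].
split; first by move=> y Ay; apply: continuousD; [exact: cf|exact: cg].
case: df => df pf; case: dg => dg pg; split.
  by move=> y Ay i; apply: derivableD; [exact: df|exact: dg].
move=> i; apply: Ck_eq (IH _ _ (pf i) (pg i)) => z Az.
by rewrite /partial deriveD//; [exact: df|exact: dg].
Qed.

Lemma CkM k f g : Ck k f -> Ck k g -> Ck k (fun y => f y * g y).
Proof.
elim: k f g => [|k IH] f g.
  by move=> [cf _] [cg _]; split=> // y Ay; apply: continuousM;
    [exact: cf|exact: cg].
move=> cf1 cg1; have := (cf1, cg1).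
move=> [[cf [df pf]] [cg [dg pg]]].
split; first by move=> y Ay; apply: continuousM; [exact: cf|exact: cg].
split; first by move=> y Ay i; apply: derivableM; [exact: df|exact: dg].
move=> i; apply: Ck_eq (CkD (IH _ _ (CkW cf1) (pg i)) (IH _ _ (CkW cg1) (pf
  i))).
move=> z Az; rewrite /partial.
by rewrite (deriveM (df z Az i) (dg z Az i)).
Qed.

Lemma CkV k f : (forall y, A y -> f y != 0) -> Ck k f -> Ck k (fun y =>
  (f y)^-1).
Proof.
move=> f0; elim: k => [|k IH].
  by move=> [cf _]; split=> // y Ay; apply: continuousV; [exact: f0|exact: cf].
move=> cf1; have [cf [df pf]] := cf1.
split; first by move=> y Ay; apply: continuousV; [exact: f0|exact: cf].
split; first by move=> y Ay i; apply: derivableV; [exact: f0|exact: df].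
move=> i; have Ik := IH (CkW cf1).
apply: Ck_eq (CkM (Ck_cst k (-1)) (CkM (CkM Ik Ik) (pf i))) => z Az.
rewrite /partial (deriveV (f0 z Az) (df z Az i)) mulN1r scaleNr.
by rewrite -exprVn expr2.
Qed.

Lemma smooth_on_cst (c : R) : smooth_on A (fun=> c).
Proof. by apply/smooth_onP => k; exact: Ck_cst. Qed.

Lemma smooth_onD f g : smooth_on A f -> smooth_on A g ->
  smooth_on A (fun y => f y + g y).
Proof. by move=> /smooth_onP cf /smooth_onP cg; apply/smooth_onP => k;
  exact: CkD. Qed.

Lemma smooth_onM f g : smooth_on A f -> smooth_on A g ->
  smooth_on A (fun y => f y * g y).
Proof. by move=> /smooth_onP cf /smooth_onP cg; apply/smooth_onP => k;
  exact: CkM. Qed.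

Lemma smooth_onV f : (forall y, A y -> f y != 0) -> smooth_on A f ->
  smooth_on A (fun y => (f y)^-1).
Proof. by move=> f0 /smooth_onP cf; apply/smooth_onP => k; exact: CkV. Qed.

Lemma smooth_on_sum (I : Type) (r : seq I) (F : I -> 'rV[R]_n -> R) :
  (forall i, smooth_on A (F i)) -> smooth_on A (fun y => \sum_(i <- r) F i y).
Proof.
move=> sF; elim: r => [|i r IH].
  by apply: smooth_on_eq (smooth_on_cst 0) => z _; rewrite big_nil.
by apply: smooth_on_eq (smooth_onD (sF i) IH) => z _; rewrite big_cons.
Qed.

Lemma smooth_on_dir f v : smooth_on A f -> smooth_on A (dir v f).
Proof.
move=> sf; apply: smooth_on_sum => i; apply: smooth_onM.
  exact: smooth_on_cst.
exact: smooth_on_partial.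
Qed.

Lemma smooth_on_continuous f y : smooth_on A f -> A y -> {for y, continuous f}.
Proof. by move=> sf Ay; case: (sf [::] y Ay). Qed.

Lemma smooth_on_differentiable f y : smooth_on A f -> A y ->
  'd f y = (fun v => dir v f y) :> ('rV[R]_n -> R) /\ differentiable f y.
Proof.
move=> sf Ay; apply: C1_differentiable => i; last first.
  exact: smooth_on_continuous (smooth_on_partial _ sf) Ay.
near=> z; have Az : A z by near: z; exact: open_nbhs_nbhs.
by case: (sf [::] z Az).
Unshelve. all: by end_near. Qed.

Lemma smooth_on_derive f y v : smooth_on A f -> A y ->
  is_derive y v f (dir v f y).
Proof.
move=> sf Ay; have [dE df] := smooth_on_differentiable sf Ay.
by apply: DeriveDef; [exact: diff_derivable|rewrite deriveE// dE].
Qed.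

Lemma dirE f y v : smooth_on A f -> A y -> dir v f y = 'D_v f y.
Proof. by move=> sf Ay; have [_ ->] := smooth_on_derive v sf Ay. Qed.

Lemma dir_eq f g v y : A y -> (forall z, A z -> f z = g z) ->
  dir v f y = dir v g y.
Proof. by move=> Ay fg; apply: eq_bigr => i _; rewrite (partial_eq i Ay fg).
  Qed.

Lemma dir_cst (c : R) v y : dir v (fun=> c) y = 0.
Proof. by rewrite /dir big1// => i _; rewrite partial_cst mulr0. Qed.

Lemma dirDv u v f y : dir (u + v) f y = dir u f y + dir v f y.
Proof. by rewrite /dir -big_split; apply: eq_bigr => i _;
  rewrite mxE mulrDl. Qed.

Lemma dirZv (c : R) v f y : dir (c *: v) f y = c * dir v f y.
Proof. by rewrite /dir mulr_sumr; apply: eq_bigr => i _; rewrite mxE mulrA. Qed.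

Lemma dir0v f y : dir 0 f y = 0.
Proof. by rewrite -(scale0r (0 : 'rV[R]_n)) dirZv mul0r. Qed.

Lemma dir_delta i f y : dir (delta_mx 0 i) f y = partial i f y.
Proof.
rewrite /dir (bigD1 i)//= mxE !eqxx mul1r big1 ?addr0// => j ji.
by rewrite mxE (negbTE ji) andbF mul0r.
Qed.

Opaque dir smooth_on.

Lemma dirD f g v y : smooth_on A f -> smooth_on A g -> A y ->
  dir v (fun z => f z + g z) y = dir v f y + dir v g y.
Proof.
move=> sf sg Ay; have [df <-] := smooth_on_derive v sf Ay.
have [dg <-] := smooth_on_derive v sg Ay.
rewrite (dirE _ (smooth_onD sf sg) Ay); exact: deriveD df dg.
Qed.

Lemma dirM f g v y : smooth_on A f -> smooth_on A g -> A y ->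
  dir v (fun z => f z * g z) y = dir v f y * g y + f y * dir v g y.
Proof.
move=> sf sg Ay; have [df <-] := smooth_on_derive v sf Ay.
have [dg <-] := smooth_on_derive v sg Ay.
rewrite (dirE _ (smooth_onM sf sg) Ay).
rewrite (deriveM df dg) addrC; congr (_ + _); exact: mulrC.
Qed.

Lemma dirZ (c : R) f v y : smooth_on A f -> A y ->
  dir v (fun z => c * f z) y = c * dir v f y.
Proof.
by move=> sf Ay; rewrite (dirM _ (smooth_on_cst c) sf Ay) dir_cst mul0r add0r.
Qed.

Lemma dirV f v y : (forall z, A z -> f z != 0) -> smooth_on A f -> A y ->
  dir v (fun z => (f z)^-1) y = - ((f y)^-1 * (f y)^-1 * dir v f y).
Proof.
move=> f0 sf Ay; have [df <-] := smooth_on_derive v sf Ay.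
rewrite (dirE _ (smooth_onV f0 sf) Ay).
rewrite (deriveV (f0 y Ay) df) scaleNr -exprVn expr2; reflexivity.
Qed.

Lemma dir_sum (I : Type) (r : seq I) (F : I -> 'rV[R]_n -> R) v y :
  (forall i, smooth_on A (F i)) -> A y ->
  dir v (fun z => \sum_(i <- r) F i z) y = \sum_(i <- r) dir v (F i) y.
Proof.
move=> sF Ay; elim: r => [|i r IH].
  rewrite big_nil (@dir_eq _ (fun=> 0)) ?dir_cst// => z _; exact: big_nil.
rewrite big_cons -IH -(dirD _ (sF i) (smooth_on_sum r sF) Ay).
by apply: dir_eq => // z _; rewrite big_cons.
Qed.

Lemma dir2E f u v y : smooth_on A f -> A y ->
  dir v (dir u f) y = \sum_i \sum_j hessian f y i j * u 0 i * v 0 j.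
Proof.
move=> sf Ay; have sp i : smooth_on A (fun z => u 0 i * partial i f z).
  by apply: smooth_onM (smooth_on_cst _) _; exact: smooth_on_partial.
rewrite [LHS]big_mkcond /= exchange_big /=.
apply: eq_bigr => j _; rewrite -dir_delta.
have -> : dir (delta_mx 0 j) (dir u f) y
    = dir (delta_mx 0 j) (fun z => \sum_i u 0 i * partial i f z) y by [].
rewrite (dir_sum _ _ sp Ay) mulr_sumr; apply: eq_bigr => i _.
rewrite (dirZ _ _ (smooth_on_partial i sf) Ay) dir_delta mxE.
by rewrite [RHS]mulrC mulrA mulrAC mulrA.
Qed.

End SmoothFunctions.

(* Otherwise [//] tries to unify directional derivatives by unfolding them down
   to limits. *)
Opaque dir smooth_on.

(** * Symmetry of second derivatives *)

Section Schwarz.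
Variables (R : realType) (n : nat) (A : set 'rV[R]_n).
Hypothesis Aopen : open A.
Implicit Types (f : 'rV[R]_n -> R) (y u v : 'rV[R]_n).

Lemma is_derive_dir_line f y v (t : R) : smooth_on A f -> A (y + t *: v) ->
  is_derive t 1 (fun s : R => f (y + s *: v)) (dir v f (y + t *: v)).
Proof.
move=> sf Ay; have [df <-] := smooth_on_derive Aopen v sf Ay.
exact: is_derive_line.
Qed.

(** The mean value theorem is applied along [u] to the difference of [f] on two parallel segments,
    then along [v] to [dir u f]. *)
Lemma second_difference f y u v (r : R) : smooth_on A f -> ball y r `<=` A ->
  `|u| + `|v| < r ->
  exists2 z, `|z - y| <= `|u| + `|v| &
    f (y + u + v) - f (y + u) - (f (y + v) - f y) = dir v (dir u f) z.
Proof.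
move=> sf yA uvr.
have dist (s t : R) : 0 <= s <= 1 -> 0 <= t <= 1 ->
    `|y + s *: u + t *: v - y| <= `|u| + `|v|.
  move=> /andP[s0 s1] /andP[t0 t1].
  rewrite -(addrA y) [y + _]addrC addrK (le_trans (ler_normD _ _))// !normrZ
    !ger0_norm//.
  by rewrite lerD// ler_piMl.
have inA (s t : R) : 0 <= s <= 1 -> 0 <= t <= 1 -> A (y + s *: u + t *: v).
  move=> s01 t01; apply: yA; rewrite -ball_normE /= distrC.
  exact: le_lt_trans (dist _ _ s01 t01) uvr.
have I0 : 0 <= (0 : R) <= 1 by rewrite lexx ler01.
have I1 : 0 <= (1 : R) <= 1 by rewrite lexx ler01.
have [s s01|a a01 Ea] := @MVT01 R (fun s => f (y + v + s *: u) - f (y + s *: u))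
    (fun s => dir u f (y + v + s *: u) - dir u f (y + s *: u)).
  apply: is_deriveB; apply: is_derive_dir_line => //.
    by rewrite addrAC -[v]scale1r; exact: inA.
  by have := inA _ _ s01 I0; rewrite scale0r addr0.
have a01' : 0 <= a <= 1 by case/andP: a01 => ? ?; rewrite !ltW.
have sdu := smooth_on_dir Aopen u sf.
have [s s01|b b01 Eb] := @MVT01 R (fun s => dir u f (y + a *: u + s *: v))
    (fun s => dir v (dir u f) (y + a *: u + s *: v)).
  by apply: is_derive_dir_line => //; exact: inA.
have b01' : 0 <= b <= 1 by case/andP: b01 => ? ?; rewrite !ltW.
exists (y + a *: u + b *: v); first exact: dist.
rewrite -Eb; move: Ea; rewrite !scale1r !scale0r !addr0 => Ea.
rewrite [y + a *: u + v]addrAC -Ea [y + v + u]addrAC.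
by rewrite !opprB addrACA [- f _ + _]addrC.
Qed.

(** The second difference is symmetric in [u] and [v], so the two mixed derivatives agree at two
    points close to [y]; continuity brings both to [y]. *)
Lemma dir_comm f y u v : smooth_on A f -> A y ->
  dir u (dir v f) y = dir v (dir u f) y.
Proof.
move=> sf Ay; have suv := smooth_on_dir Aopen u (smooth_on_dir Aopen v sf).
have svu := smooth_on_dir Aopen v (smooth_on_dir Aopen u sf).
apply/eqP; rewrite -subr_eq0 -normr_le0; apply/ler_addgt0Pl => e e0.
rewrite addr0; have e2 : 0 < e / 2 by rewrite divr_gt0.
have near1 : \forall z \near y, A z /\
    `|dir u (dir v f) y - dir u (dir v f) z| <= e / 2 /\
    `|dir v (dir u f) y - dir v (dir u f) z| <= e / 2.
  apply: filterI; first exact: open_nbhs_nbhs.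
  apply: filterI.
    exact: cvgr_dist_le (smooth_on_continuous suv Ay) _ e2.
  exact: cvgr_dist_le (smooth_on_continuous svu Ay) _ e2.
have /nbhs_ballP[r /= r0 Hr] := near1.
have rA : ball y r `<=` A by move=> z /Hr[].
(* Scaling by [s] fits both directions into the ball; the [+ 1] keeps the denominator positive when
   [u = v = 0]. *)
pose s := r / (2 * (`|u| + `|v| + 1)).
have D0 : 0 < `|u| + `|v| + 1 by rewrite ltr_wpDl// addr_ge0.
have s0 : 0 < s by rewrite divr_gt0// mulr_gt0.
have sr : `|s *: u| + `|s *: v| < r.
  have nz (w : 'rV[R]_n) : `|s *: w| = s * `|w| by rewrite normrZ gtr0_norm.
  rewrite !nz -mulrDr /s.
  rewrite -mulrA gtr_pMr// mulrC ltr_pdivrMr ?mulr_gt0// mul1r.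
  have := normr_ge0 u; have := normr_ge0 v; lra.
have sr' : `|s *: v| + `|s *: u| < r by rewrite addrC.
have [p py Ep] := second_difference sf rA sr.
have [q qy Eq] := second_difference sf rA sr'.
have Epq : dir (s *: v) (dir (s *: u) f) p = dir (s *: u) (dir (s *: v) f) q.
  rewrite -Ep -Eq [y + s *: v + s *: u]addrAC.
  by move: (f _) (f _) (f _) (f _) => a b c d; ring.
have E2 (w w' z : 'rV[R]_n) : A z -> dir (s *: w) (dir (s *: w') f) z = s * s *
  dir w (dir w' f) z.
  move=> Az; rewrite dirZv -mulrA; congr (_ * _).
  rewrite -(dirZ Aopen s w (smooth_on_dir Aopen w' sf) Az).
  by apply: (dir_eq Aopen w Az) => x _; exact: dirZv.
have pb : ball y r p by rewrite -ball_normE /= distrC; exact: le_lt_trans py sr.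
have qb : ball y r q by rewrite -ball_normE /= distrC;
  exact: le_lt_trans qy sr'.
have [pA [_ p1]] := Hr _ pb; have [qA [q1 _]] := Hr _ qb.
move: Epq; rewrite (E2 _ _ _ pA) (E2 _ _ _ qA) => /mulfI Epq.
have {}Epq : dir v (dir u f) p = dir u (dir v f) q.
  by apply: Epq; rewrite mulf_neq0// gt_eqF.
have key (a b c d : R) : c = d -> a - b = (a - d) - (b - c) by move=> ->; ring.
rewrite (key _ _ _ _ Epq).
apply: le_trans (ler_normB _ _) _.
by rewrite [leRHS](splitr e); exact: lerD q1 p1.
Qed.

End Schwarz.

(** * Homogeneous functions and Euler's identity *)

Section Homogeneous.
Variables (R : realType) (n : nat).
Implicit Types (f : 'rV[R]_n -> R) (y u v : 'rV[R]_n) (c : R -> R).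

Lemma open_neq0 : open [set y : 'rV[R]_n | y != 0].
Proof.
rewrite openE => y /= y0; rewrite /interior; near=> z.
by near: z; exact: (@cvgr_neq0 _ _ _ (nbhs y) _ id y cvg_id y0).
Unshelve. all: by end_near. Qed.

Definition smooth0 f := smooth_on [set y : 'rV[R]_n | y != 0] f.

(** The factor is an arbitrary [c l]: the derivatives of a norm have degrees 1, 0, -1, ..., and
    passing to a derivative just divides [c l] by [l]. *)
Definition homog c f := forall (l : R) y, 0 < l -> y != 0 ->
  f (l *: y) = c l * f y.

(** Differentiate [f (y + s y) = c (1 + s) * f y] at [s = 0]; [k] is the derivative of [c] at 1. *)
Lemma euler c f y (k : R) : smooth0 f -> homog c f -> y != 0 ->
  is_derive (0 : R) 1 (fun s => c (1 + s)) k -> dir y f y = k * f y.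
Proof.
move=> sf hf y0 dc.
have d1 : is_derive (0 : R) 1 (fun s : R => f (y + s *: y)) (dir y f y).
  have := @is_derive_dir_line R n _ open_neq0 f y y 0 sf.
  by rewrite scale0r addr0; apply.
have d2 : is_derive (0 : R) 1 (fun s : R => c (1 + s) * f y) (dir y f y).
  apply: near_eq_is_derive d1.
  have near1 : \forall s \near (0 : R), `|s| < 1 by exact: nbhs0_lt.
  near=> s; have s1 : `|s| < 1 by near: s.
  rewrite -hf//; first by rewrite scalerDl scale1r.
  by move: s1; rewrite ltr_norml => /andP[s1 _]; rewrite -ltrBlDl sub0r.
have d3 : is_derive (0 : R) 1 (fun s : R => c (1 + s) * f y) (k * f y).
  apply: (@is_derive_eq _ _ _ _ _ _ _ _ (is_deriveM dc (is_derive_cst (f y) _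
    _))).
  by rewrite scaler0 add0r mulrC.
by have [_ <-] := d2; have [_ <-] := d3.
Unshelve. all: by end_near. Qed.

(** Differentiate [f (l y + s l v) = c l * f (y + s v)] at [s = 0]; the direction [l *: v] on the
    left costs the factor [l]. *)
Lemma homog_dir c f v : smooth0 f -> homog c f ->
  homog (fun l => c l / l) (dir v f).
Proof.
move=> sf hf l y l0 y0.
have ly0 : l *: y != 0 by rewrite scaler_eq0 negb_or gt_eqF.
have d1 : is_derive (0 : R) 1 (fun s : R => f (l *: y + s *: (l *: v)))
    (dir (l *: v) f (l *: y)).
  have := @is_derive_dir_line R n _ open_neq0 f (l *: y) (l *: v) 0 sf.
  by rewrite scale0r addr0; apply.
have d2 : is_derive (0 : R) 1 (fun s : R => f (y + s *: v)) (dir v f y).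
  have := @is_derive_dir_line R n _ open_neq0 f y v 0 sf.
  by rewrite scale0r addr0; apply.
have d3 : is_derive (0 : R) 1 (fun s : R => f (l *: y + s *: (l *: v))) (c l *
  dir v f y).
  have d4 : is_derive (0 : R) 1 (fun s : R => c l * f (y + s *: v)) (c l * dir
    v f y).
    apply: (@is_derive_eq _ _ _ _ _ _ _ _ (is_deriveM (is_derive_cst (c l) _ _)
      d2)).
    by rewrite scaler0 addr0.
  apply: near_eq_is_derive d4.
  have cl : (fun s : R => y + s *: v) @ (0 : R) --> y.
    rewrite -[X in _ --> X]addr0 -[X in _ + X](scale0r v).
    by apply: cvgD; [exact: cvg_cst|apply: cvgZr_tmp; exact: cvg_id].
  near=> s; rewrite -hf//; first by rewrite scalerDr !scalerA mulrC.
  by near: s; exact: cvgr_neq0 cl y0.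
have E : dir (l *: v) f (l *: y) = c l * dir v f y.
  by have [_ <-] := d1; have [_ <-] := d3.
move: E; rewrite dirZv => E.
rewrite mulrAC -E [l * _]mulrC mulfK// gt_eqF//.
Unshelve. all: by end_near. Qed.

Lemma smooth0_dir v f : smooth0 f -> smooth0 (dir v f).
Proof. exact: smooth_on_dir open_neq0 _ _. Qed.

End Homogeneous.

(** * Homogeneous functions with positive definite Hessian *)

Section Parallel.
Variables (R : realType) (n : nat).
Implicit Types (y v w : 'rV[R]_n).

Definition parallel y v := exists c : R, v = c *: y.

Lemma not_parallel_free y v (a b : R) : y != 0 -> ~ parallel y v ->
  a *: y + b *: v = 0 -> a = 0 /\ b = 0.
Proof.
move=> y0 yv /eqP; rewrite addr_eq0 => /eqP E.
have b0 : b = 0.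
  apply/eqP/negP => /negP b0; apply: yv; exists (- (b^-1 * a)).
  by rewrite scaleNr -scalerA E scalerN scalerA mulVf// scale1r opprK.
split=> //; move/eqP: E.
by rewrite b0 scale0r oppr0 scaler_eq0 (negbTE y0) orbF => /eqP.
Qed.

Lemma not_parallel_comb y v (a b c d : R) : y != 0 -> ~ parallel y v ->
  a * d - b * c != 0 -> ~ parallel (a *: y + b *: v) (c *: y + d *: v).
Proof.
move=> y0 yv D [k /eqP]; rewrite -subr_eq0 scalerDr !scalerA => /eqP E.
have : (c - k * a) *: y + (d - k * b) *: v = 0.
  by rewrite -E !scalerBl opprD addrACA.
move=> /(not_parallel_free y0 yv)[c1 d1].
move/negP: D; apply; apply/eqP.
have -> : c = k * a by apply/eqP; rewrite -subr_eq0 c1.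
have -> : d = k * b by apply/eqP; rewrite -subr_eq0 d1.
ring.
Qed.

End Parallel.

Section EllipticNorms.
Variables (R : realType) (n : nat) (f : 'rV[R]_n -> R).
Implicit Types (y z u v w : 'rV[R]_n).
Hypothesis f_ge0 : forall y, 0 <= f y.
Hypothesis f_eq0 : forall y, f y = 0 <-> y = 0.
Hypothesis f_homo : forall (a : R) y, 0 < a -> f (a *: y) = a * f y.
Hypothesis f_smooth : smooth0 f.

Let f_gt0 y : y != 0 -> 0 < f y.
Proof.
move=> y0; rewrite lt_def f_ge0 andbT.
by apply: contraNN y0 => /eqP/f_eq0/eqP.
Qed.

Lemma dir_homo1 y : y != 0 -> dir y f y = f y.
Proof.
move=> y0; have hf : homog id f by move=> l z l0 _; exact: f_homo.
have dc : is_derive (0 : R) 1 (fun s : R => 1 + s) 1.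
  have := is_deriveD (is_derive_cst (1 : R) (0 : R) 1) (is_derive_id (0 : R) 1).
  by rewrite add0r.
by rewrite (euler f_smooth hf y0 dc) mul1r.
Qed.

Lemma dir2_homo1 y v : y != 0 -> dir y (dir v f) y = 0.
Proof.
move=> y0; have hf : homog id f by move=> l z l0 _; exact: f_homo.
have hv : homog (fun=> 1) (dir v f).
  by move=> l z l0 z0; rewrite (homog_dir v f_smooth hf l0 z0) divff// gt_eqF.
have dc : is_derive (0 : R) 1 (fun=> 1 : R) 0 by exact: is_derive_cst.
by rewrite (euler (smooth0_dir v f_smooth) hv y0 dc) mul0r.
Qed.

(** [y] lies in the kernel of the second derivative at [y]. Hence [v] may be corrected by a multiple
    of [y] to annihilate the first derivative without changing the second. *)
Lemma dir2_homo1_comb y v (c : R) : y != 0 ->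
  dir (v + c *: y) (dir (v + c *: y) f) y = dir v (dir v f) y.
Proof.
move=> y0; have sv := smooth0_dir v f_smooth.
rewrite dirDv dirZv (dir2_homo1 _ y0) mulr0 addr0.
rewrite (dir_comm (@open_neq0 R n) v _ f_smooth y0) dirDv dirZv.
by rewrite (dir2_homo1 _ y0) mulr0 addr0.
Qed.

Lemma dir2_sqr y u v : y != 0 -> dir v (dir u (fun z => f z ^+ 2)) y
  = 2 * (dir u f y * dir v f y + f y * dir v (dir u f) y).
Proof.
move=> y0; have su := smooth0_dir u f_smooth.
have sM := smooth_onM (@open_neq0 R n) f_smooth su.
rewrite (@dir_eq _ _ _ (@open_neq0 R n) _ (fun z =>
  2 * (f z * dir u f z)) _ _ y0); last first.
  move=> z z0; rewrite (_ : (fun z => f z ^+ 2) = (fun z => f z * f z)).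
    rewrite (dirM (@open_neq0 R n) u f_smooth f_smooth z0).
    by move: (dir u f z) (f z) => a b; ring.
  by apply/funext => w; exact: expr2.
rewrite (dirZ (@open_neq0 R n) _ _ sM y0) (dirM (@open_neq0 R n) v f_smooth su
  y0).
by rewrite [_ * dir u f y]mulrC; reflexivity.
Qed.

Lemma smooth_sqr : smooth0 (fun z => f z ^+ 2).
Proof.
have sM := smooth_onM (@open_neq0 R n) f_smooth f_smooth.
rewrite (_ : (fun z => f z ^+ 2) = (fun z => f z * f z)); first exact: sM.
by apply/funext => w; exact: expr2.
Qed.

Lemma hessian_sqrE y v : y != 0 ->
  \sum_i \sum_j hessian (fun z => f z ^+ 2) y i j * v 0 i * v 0 j
  = 2 * (dir v f y ^+ 2 + f y * dir v (dir v f) y).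
Proof.
move=> y0; rewrite -(dir2E (@open_neq0 R n) _ _ smooth_sqr y0) (dir2_sqr _ _
  y0).
by rewrite [_ ^+ 2]expr2; reflexivity.
Qed.

(** The form of [f^2] is [2 (f_v^2 + f f_vv)]. The square vanishes for a suitable representative of
    [v] modulo [y], and along [y] itself it is the positive term. *)
Lemma posdef_sqrP y : y != 0 -> posdef (hessian (fun z => f z ^+ 2) y) <->
  forall v, ~ parallel y v -> 0 < dir v (dir v f) y.
Proof.
move=> y0; have fy := f_gt0 y0; split=> H v yv.
  (* By Euler's identity the first derivative along [v + c *: y] vanishes, leaving only [f f_vv]. *)
  pose c := - (dir v f y / f y).
  have w0 : v + c *: y != 0.
    apply/eqP => E; apply: yv; exists (- c).
    by apply/eqP; rewrite scaleNr -addr_eq0 E.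
  have := H _ w0; rewrite (hessian_sqrE _ y0) (dir2_homo1_comb _ _ y0).
  rewrite dirDv dirZv (dir_homo1 y0) /c mulNr divfK ?gt_eqF// subrr expr0n
    add0r.
  by rewrite pmulr_rgt0// pmulr_rgt0.
rewrite (hessian_sqrE _ y0) pmulr_rgt0//.
have [[c vc]|yv'] := pselect (parallel y v); last first.
  by rewrite ltr_wpDl ?sqr_ge0// mulr_gt0// H.
have c0 : c != 0 by apply: contraNneq yv => c0; rewrite vc c0 scale0r.
have -> : dir v (dir v f) y = 0.
  by rewrite {1}vc dirZv (dir2_homo1 _ y0) mulr0; reflexivity.
rewrite mulr0 addr0 vc dirZv (dir_homo1 y0) exprn_even_gt0//=.
by rewrite mulf_neq0// gt_eqF.
Qed.

Hypothesis f_elliptic : forall y, y != 0 -> posdef (hessian (fun z =>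
  f z ^+ 2) y).

(** The segment from [z] to [w] avoids the origin and its direction is nowhere parallel to the
    current point, so [f] is strictly convex on it and lies above its tangent at [z]. By Euler's
    identity that tangent takes the value [dir w f z] at [w]. *)
Lemma elliptic_tangent_lt z w : z != 0 -> ~ parallel z w -> dir w f z < f w.
Proof.
move=> z0 zw; pose v := w - z.
have zv : z + v = w by rewrite /v addrC subrK.
have vE : v = (-1) *: z + 1 *: w by rewrite scaleN1r scale1r addrC.
have Dv : dir v f z = dir w f z - f z.
  by rewrite /v -[- z]scaleN1r dirDv dirZv (dir_homo1 z0) mulN1r; reflexivity.
have E (t : R) : z + t *: v = (1 - t) *: z + t *: w.
  by rewrite /v scalerBr scalerBl scale1r addrA addrAC.
have n0 (t : R) : z + t *: v != 0.
  apply/eqP; rewrite E => /(not_parallel_free z0 zw)[t1 t0].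
  by move: t1; rewrite t0 subr0 => /eqP; rewrite oner_eq0.
have np (t : R) : ~ parallel (z + t *: v) v.
  rewrite E vE.
  apply: not_parallel_comb => //.
  by rewrite mulr1 mulrN1 opprK subrK oner_neq0.
clearbody v; have op := @open_neq0 R n.
(* The slope at an interior point [c] equals [f w - f z]; a second mean value argument, between 0
   and [c], shows that it exceeds the slope at [z]. *)
have [t t01|c /andP[c0 c1]] := @MVT01 R (fun s => f (z + s *: v)) (fun s =>
  dir v f (z + s *: v)).
  by apply: (is_derive_dir_line op f_smooth); exact: n0.
rewrite scale1r scale0r addr0 zv => Ec.
have [t t01|d d01] := @MVT01 R (fun s => dir v f (z + s *: (c *: v)))
   (fun s => dir (c *: v) (dir v f) (z + s *: (c *: v))).
  apply: (is_derive_dir_line op (smooth0_dir v f_smooth)).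
  by rewrite scalerA; exact: n0.
rewrite scale1r scale0r addr0 dirZv scalerA => Ed.
have P := (posdef_sqrP (n0 (d * c))).1 (f_elliptic (n0 (d * c))) v (np (d * c)).
have : 0 < dir v f (z + c *: v) - dir v f z by rewrite Ed mulr_gt0.
by rewrite -Ec subr_gt0 Dv ltrD2r.
Qed.

(** Stated with [?= iff] so that [leifD] carries the equality cases over to the triangle
    inequality. *)
Lemma elliptic_tangent_le z w : z != 0 -> dir w f z <= f w ?= iff `[< exists2 c
  : R, 0 <= c & w = c *: z >].
Proof.
move=> z0; apply/leifP.
case: asboolP => [[c c0 ->]|H].
  rewrite dirZv (dir_homo1 z0).
  move: c0; rewrite le_eqVlt => /predU1P[<-|c0]; last by rewrite f_homo.
  by rewrite mul0r scale0r ((f_eq0 0).2 erefl).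
have [[c wc]|] := pselect (parallel z w); last exact: elliptic_tangent_lt.
have c0 : c < 0.
  by rewrite ltNge; apply/negP => c0; apply: H; exists c.
rewrite wc dirZv (dir_homo1 z0).
by apply: lt_le_trans (f_ge0 _); rewrite nmulr_rlt0// f_gt0.
Qed.

(** With [s = y1 + y2], Euler's identity gives [f s = dir y1 f s + dir y2 f s], and each term is at
    most [f y1], respectively [f y2]. Equality puts both vectors on the ray of [s]. *)
Lemma elliptic_minkowski : minkowski_norm f.
Proof.
have tri y1 y2 : f (y1 + y2) <= f y1 + f y2 /\
    (f (y1 + y2) = f y1 + f y2 -> exists a1 a2 : R,
      [/\ 0 <= a1, 0 <= a2, 0 < a1 + a2 & a1 *: y1 = a2 *: y2]).
  (* At the origin [f] has no tangent, but there [f (y1 + y2) = 0]. *)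
  have [s0|s0] := eqVneq (y1 + y2) 0.
    have fs : f (y1 + y2) = 0 by apply/f_eq0.
    rewrite fs; split=> [|E]; first by rewrite addr_ge0.
    have /eqP : f y1 + f y2 = 0 by rewrite E.
    rewrite paddr_eq0// => /andP[/eqP/f_eq0 -> /eqP/f_eq0 ->].
    by exists 1, 1; split.
  have E : f (y1 + y2) = dir y1 f (y1 + y2) + dir y2 f (y1 + y2).
    by rewrite -dirDv (dir_homo1 s0).
  have l1 := elliptic_tangent_le y1 s0; have l2 := elliptic_tangent_le y2 s0.
  have [le eq] := leifD l1 l2; rewrite -E in le eq; split=> // Eq.
  move: eq; rewrite Eq eqxx => /esym/andP[/asboolP[c1 c10 E1] /asboolP[c2 c20
    E2]].
  have c12 : c1 + c2 = 1.
    apply/eqP; rewrite -subr_eq0.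
    have : (c1 + c2 - 1) *: (y1 + y2) = 0.
      by rewrite scalerBl scalerDl scale1r -E1 -E2 subrr.
    by move/eqP; rewrite scaler_eq0 (negbTE s0) orbF.
  exists c2, c1; split; rewrite ?[c2 + c1]addrC ?c12//.
  by rewrite {1}E1 {2}E2 !scalerA mulrC.
split=> //; split=> //.
  split=> // y1 y2; exact: (tri y1 y2).1.
by move=> y1 y2; exact: (tri y1 y2).2.
Qed.

End EllipticNorms.

(** * The change of variables [xi = y + P x] *)

Section DerivativeTools.
Variables (R : realType) (V W : normedModType R).

Lemma is_derive_cvg (f : V -> W) y v d :
  (fun h : R => h^-1 *: (f (h *: v + y) - f y)) @ (0 : R)^' --> d ->
  is_derive y v f d.
Proof. by move=> fd; apply: DeriveDef; [exact: cvgP fd|exact: cvg_lim fd]. Qed.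

Lemma is_derive_cvgP (f : V -> W) y v d : is_derive y v f d ->
  (fun h : R => h^-1 *: (f (h *: v + y) - f y)) @ (0 : R)^' --> d.
Proof. by move=> [df <-]. Qed.

End DerivativeTools.

Section DerivativeAlong.
Variables (R : realType) (V W : normedModType R).

Lemma is_derive_along (f : V -> W) y v d :
  is_derive (0 : R) 1 (fun s : R => f (y + s *: v)) d -> is_derive y v f d.
Proof.
move=> /is_derive_cvgP fd; apply: is_derive_cvg.
have E : (fun h : R => h^-1 *: (f (y + (h *: 1 + 0) *: v) - f (y + 0 *: v)))
  = (fun h : R => h^-1 *: (f (h *: v + y) - f y)).
  by apply/funext => h; rewrite addr0 [h *: 1]mulr1 scale0r addr0 [y + _]addrC.
by rewrite -E.
Qed.

Lemma is_derive_scalel (g : R -> R) (x : V) (t d : R) : is_derive t 1 g d ->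
  is_derive t 1 (fun s => g s *: x) (d *: x).
Proof.
move=> /is_derive_cvgP gd; apply: is_derive_cvg.
have E : (fun h : R => (h^-1 *: (g (h *: 1 + t) - g t)) *: x)
  = (fun h : R => h^-1 *: (g (h *: 1 + t) *: x - g t *: x)).
  by apply/funext => h; rewrite -scalerBl scalerA.
by rewrite -E; apply: cvgZr_tmp.
Qed.

End DerivativeAlong.

Section ChainRule.
Variables (R : realType) (n : nat).

Lemma is_derive_chain (K : 'rV[R]_n -> R) (c : R -> 'rV[R]_n) v :
  smooth0 K -> c 0 != 0 -> is_derive (0 : R) 1 c v ->
  is_derive (0 : R) 1 (fun s => K (c s)) (dir v K (c 0)).
Proof.
move=> sK c0 [dc cv].
have [dE dK] := smooth_on_differentiable (@open_neq0 R n) sK c0.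
have dc' : differentiable c 0 by apply/derivable1_diffP.
have dKc : differentiable (K \o c) 0 by exact: differentiable_comp.
apply: DeriveDef; first exact: diff_derivable.
rewrite (deriveE _ dKc) diff_comp// dE /= -cv deriveE//; reflexivity.
Qed.

End ChainRule.

(** * Continuity and derivative bounds for pseudo-norms *)

Section PseudoNorm.
Variables (R : realType) (n : nat) (phi : 'rV[R]_n -> R).
Hypothesis phiP : pseudo_norm phi.
Implicit Types (x y v : 'rV[R]_n).

Lemma pseudo_norm0 : phi 0 = 0.
Proof. exact/(pn_eq0 phiP). Qed.

Lemma pseudo_norm_gt0 y : y != 0 -> 0 < phi y.
Proof.
move=> y0; rewrite lt_def (pn_ge0 phiP) andbT.
by apply: contraNN y0 => /eqP/(pn_eq0 phiP)/eqP.
Qed.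

Lemma pseudo_norm_scale y (a : R) : 0 <= a -> phi (a *: y) = a * phi y.
Proof.
rewrite le_eqVlt => /predU1P[<-|]; last exact: (pn_homo phiP).
by rewrite scale0r mul0r pseudo_norm0.
Qed.

Lemma pseudo_norm_bound : exists2 C : R, 0 <= C & forall y, phi y <= C * `|y|.
Proof.
(* Both signs enter because [phi] need not be symmetric. *)
pose C i := phi (delta_mx 0 i) + phi (- delta_mx 0 i).
have C0 i : 0 <= C i by rewrite addr_ge0// (pn_ge0 phiP).
exists (\sum_i C i); first exact: sumr_ge0.
move=> y; rewrite mulr_suml {1}[y]row_sum_delta.
have H : forall r : seq 'I_n, phi (\sum_(j <- r) y 0 j *: delta_mx 0 j) <=
  \sum_(j <- r) C j * `|y|.
  elim=> [|i r IH]; first by rewrite !big_nil pseudo_norm0.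
  rewrite !big_cons (le_trans (pn_triangle phiP _ _))// lerD//.
  have yi := norm_coord y i.
  apply: (@le_trans _ _ (`|y 0 i| * C i)); last by rewrite mulrC ler_wpM2l.
  have [y0|y0] := leP 0 (y 0 i).
    rewrite pseudo_norm_scale// ger0_norm// ler_wpM2l// lerDl.
    exact: (pn_ge0 phiP).
  have -> : y 0 i *: delta_mx 0 i = (- y 0 i) *: (- delta_mx 0 i) :> 'rV[R]_n.
    by rewrite scalerN scaleNr opprK.
  rewrite ltr0_norm// pseudo_norm_scale ?oppr_ge0 ?(ltW y0)//.
  rewrite ler_wpM2l ?oppr_ge0 ?(ltW y0)// lerDr.
  exact: (pn_ge0 phiP).
exact: H.
Qed.

(** Smoothness says nothing at the origin; the triangle inequality and the linear bound give a
    Lipschitz estimate everywhere. *)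
Lemma pseudo_norm_continuous y : {for y, continuous phi}.
Proof.
have [C C0 HC] := pseudo_norm_bound.
have L (u v : 'rV[R]_n) : phi u - phi v <= C * `|u - v|.
  rewrite lerBlDr (le_trans _ (lerD (HC (u - v)) (lexx _)))//.
  by rewrite (le_trans _ (pn_triangle phiP _ _))// subrK.
apply/(@cvgrPdist_le _ _ _ (nbhs y)) => e e0.
have e1 : 0 < e / (C + 1) by rewrite divr_gt0// ltr_wpDl.
near=> z.
have zy : `|y - z| <= e / (C + 1).
  near: z; exact: (@cvgr_dist_le _ _ _ (nbhs y) _ id y cvg_id _ e1).
have Ce : C * `|y - z| <= e.
  apply: le_trans (_ : (C + 1) * `|y - z| <= _); first by rewrite ler_wpM2r//
    lerDl.
  by rewrite mulrC -ler_pdivlMr// ltr_wpDl.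
rewrite ler_norml (le_trans (L _ _) Ce) andbT lerNl opprB.
by rewrite (le_trans (L _ _))// distrC.
Unshelve. all: by end_near. Qed.

(** For [h > 0] the difference quotient is at most [phi v] by the triangle inequality. With [v = x]
    in [Omega] this keeps [den] positive. *)
Lemma dir_pseudo_norm_le y v : smooth0 phi -> y != 0 -> dir v phi y <= phi v.
Proof.
move=> sphi y0; have := smooth_on_derive (@open_neq0 R n) v sphi y0.
move=> /is_derive_cvgP/cvg_dnbhs_at_right H.
apply: (cvgr_to_le H); near=> h.
have h0 : 0 < h by near: h; exact: nbhs_right_gt.
rewrite -[_ *: _]/(_ * _) ler_pdivrMl// lerBlDl addrC.
by rewrite -(pn_homo phiP)//; exact: (pn_triangle phiP).
Unshelve. all: by end_near. Qed.

End PseudoNorm.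

Section FunkChange.
Variables (R : realType) (n : nat) (phi : 'rV[R]_n -> R) (x : 'rV[R]_n).
Hypothesis phiP : pseudo_norm phi.
Hypothesis phi_smooth : smooth0 phi.
Hypothesis x_Omega : Omega phi x.
Implicit Types (y z u v : 'rV[R]_n) (K : 'rV[R]_n -> R).

Definition xi y := y + Psol phi x y *: x.

(** Differentiating [P = phi (y + P x)] along [v] gives [P_v = phi_v + P_v phi_x]; solving for [P_v]
    divides by this factor. *)
Definition den z := 1 - dir x phi z.

(* [slope v (xi y)] is the derivative of [Psol phi x] at [y] along [v]. *)
Definition slope v z := dir v phi z / den z.

Lemma Psol_xi y : Psol phi x y = phi (xi y).
Proof. exact: PsolP. Qed.

Lemma Psol_unique y p : p = phi (y + p *: x) -> p = Psol phi x y.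
Proof.
move=> pE; have [q [_ qu]] := exists_unique_Psol y phiP x_Omega.
by rewrite -(qu _ pE); apply: qu; exact: PsolP.
Qed.

(** [xi] is a bijection with explicit inverse, so conditions on all [y] become conditions on all
    [z]. *)
Lemma xi_inv z : xi (z - phi z *: x) = z.
Proof.
by rewrite /xi -(@Psol_unique (z - phi z *: x) (phi z)) subrK.
Qed.

Lemma xi_homog (l : R) y : 0 < l -> xi (l *: y) = l *: xi y.
Proof.
move=> l0; rewrite /xi -(@Psol_unique (l *: y) (l * Psol phi x y)).
  by rewrite scalerDr scalerA.
by rewrite -scalerA -scalerDr (pn_homo phiP)// -PsolP.
Qed.

Lemma xi0 : xi 0 = 0.
Proof.
by rewrite /xi -(@Psol_unique 0 0) ?scale0r ?addr0// (pseudo_norm0 phiP).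
Qed.

Lemma xi_neq0 y : y != 0 -> xi y != 0.
Proof.
apply: contraNN => /eqP E; move: (E); rewrite /xi Psol_xi E (pseudo_norm0 phiP).
by rewrite scale0r addr0 => ->.
Qed.

Lemma den_gt0 z : z != 0 -> 0 < den z.
Proof.
move=> z0; rewrite subr_gt0; apply: le_lt_trans x_Omega.
exact: dir_pseudo_norm_le.
Qed.

Lemma smooth0_den : smooth0 den.
Proof.
have op := @open_neq0 R n.
have sN := smooth_onM op (@smooth_on_cst R n _ (-1)) (smooth0_dir x phi_smooth).
have s1 := smooth_onD op (@smooth_on_cst R n _ 1) sN.
by apply: (smooth_on_eq (@open_neq0 R n) _ s1) => z _; rewrite mulN1r.
Qed.

Lemma smooth0_denV : smooth0 (fun z => (den z)^-1).
Proof.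
apply: (smooth_onV (@open_neq0 R n) _ smooth0_den) => z z0.
by rewrite gt_eqF// den_gt0.
Qed.

Lemma smooth0_slope v : smooth0 (slope v).
Proof. exact (smooth_onM (@open_neq0 R n) (smooth0_dir v phi_smooth)
  smooth0_denV). Qed.

(** If [d = P y - P z >= 0], the triangle inequality gives [d <= phi (y - z) + d * phi x], and
    [phi x < 1] lets [d] be absorbed. *)
Lemma Psol_lipschitz : exists2 C : R, 0 <= C &
  forall y z, `|Psol phi x y - Psol phi x z| <= C * `|y - z|.
Proof.
have [C C0 HC] := pseudo_norm_bound phiP.
have px1 : 0 < 1 - phi x by rewrite subr_gt0.
exists (C / (1 - phi x)); first by rewrite divr_ge0// ltW.
have L y z : Psol phi x z <= Psol phi x y ->
    Psol phi x y - Psol phi x z <= C / (1 - phi x) * `|y - z|.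
  rewrite -subr_ge0 => d0.
  rewrite mulrAC ler_pdivlMr// mulrBr mulr1 lerBlDr.
  apply: le_trans (lerD (HC _) (lexx _)).
  rewrite -(pseudo_norm_scale phiP x d0).
  apply: le_trans (pn_triangle phiP _ _).
  rewrite lerBlDr [X in X <= _]Psol_xi [X in _ <= _ + X]Psol_xi.
  apply: le_trans (pn_triangle phiP _ _).
  have -> : y - z + (Psol phi x y - Psol phi x z) *: x + xi z = xi y.
    by rewrite /xi scalerBl addrACA !subrK.
  exact: lexx.
move=> y z; have [zy|/ltW yz] := leP (Psol phi x z) (Psol phi x y).
  by rewrite ger0_norm ?subr_ge0//; exact: L.
by rewrite distrC [`|y - z|]distrC ger0_norm ?subr_ge0//; exact: L.
Qed.

(** Let [D] be the increment of [P] and [w = h v + D x] that of [xi]. As [P = phi (xi)],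
    differentiability of [phi] gives [D = h phi_v + D phi_x + o(|w|)], that is,
    [D * den - h phi_v = o(|w|)]; the Lipschitz bound makes this [o(|h|)]. *)
Lemma is_derive_Psol y v : y != 0 ->
  is_derive y v (Psol phi x) (slope v (xi y)).
Proof.
move=> y0; have z0 := xi_neq0 y0; have dz := den_gt0 z0.
have [C C0 HC] := Psol_lipschitz.
pose M := `|v| + C * `|v| * `|x|.
have M0 : 0 <= M by rewrite addr_ge0// !mulr_ge0.
have [dE dphi] := smooth_on_differentiable (@open_neq0 R n) phi_smooth z0.
apply: is_derive_cvg; apply/(@cvgrPdist_le _ _ _ ((0 : R)^')) => e e0.
(* The tolerance anticipates the bound [|w| <= |h| * M] and the final division by
   [h * den (xi y)]. *)
have e1 : 0 < e * den (xi y) / (M + 1) by rewrite divr_gt0 ?mulr_gt0// ltr_wpDl.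
have : \forall w \near (0 : 'rV[R]_n), `|phi (w + xi y) - phi (xi y) - dir w
  phi (xi y)|
    <= e * den (xi y) / (M + 1) * `|w|.
  have /eqaddoP/(_ _ e1) := diff_locally dphi.
  by rewrite dE; apply: filterS => w /=; rewrite !fctE /= opprD addrA.
move=> /nbhs_ballP[r /= r0 Hr].
have r1 : 0 < r / (M + 1) by rewrite divr_gt0// ltr_wpDl.
near=> h.
have h0 : h != 0 by near: h; exact: nbhs_dnbhs_neq.
have hr : `|h| < r / (M + 1) by near: h; exact: dnbhs0_lt.
set D := Psol phi x (h *: v + y) - Psol phi x y.
pose w := h *: v + D *: x.
have wE : w + xi y = xi (h *: v + y).
  by rewrite /w /xi /D scalerBl addrACA [_ - _ + _]addrC subrKC.
have wM : `|w| <= `|h| * M.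
  rewrite /w (le_trans (ler_normD _ _))// !normrZ mulrDr lerD2l.
  rewrite !mulrA ler_wpM2r//; have := HC (h *: v + y) y.
  by rewrite -/D addrK normrZ mulrCA mulrA.
have wr : `|w| < r.
  apply: le_lt_trans wM _; move: hr; rewrite ltr_pdivlMr ?ltr_wpDl//.
  by apply: le_lt_trans; rewrite ler_wpM2l// lerDl.
have := Hr w; rewrite -ball_normE /= sub0r normrN => /(_ wr).
rewrite wE -!Psol_xi -/D dirDv !dirZv /slope.
move: (dir v phi (xi y)) => pv.
have -> : D - (h * pv + D * dir x phi (xi y)) = D * den (xi y) - h * pv.
  by rewrite /den mulrBr mulr1 opprD addrCA addrC.
move: (den (xi y)) dz => dn dn0 in e1 Hr * => Hw.
have h1 : 0 < `|h| by rewrite normr_gt0.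
have -> : pv / dn - h^-1 *: D = - ((D * dn - h * pv) / (h * dn)).
  rewrite -[_ *: _]/(_ * _); field; by rewrite h0 gt_eqF.
rewrite normrN normrM normfV normrM (gtr0_norm dn0) ler_pdivrMr ?mulr_gt0//.
apply: le_trans Hw _; apply: le_trans (ler_wpM2l (ltW _) wM) _.
  by rewrite divr_gt0 ?mulr_gt0// ltr_wpDl.
rewrite -mulrA [X in e * X]mulrC -!mulrA ler_wpM2l ?(ltW e0)//.
rewrite ler_pdivrMl ?ltr_wpDl//.
have -> : dn * (`|h| * M) = M * (`|h| * dn) by move: (`|h|) => k; ring.
by rewrite ler_wpM2r ?mulr_ge0 ?(ltW dn0)// lerDl.
Unshelve. all: by end_near. Qed.

(** The derivative of [K \o xi] along [v], written again as a function of [xi], so that it can be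
    iterated. *)
Definition push v K z := dir v K z + slope v z * dir x K z.

Lemma push_dir v K z : push v K z = dir (v + slope v z *: x) K z.
Proof. by rewrite dirDv dirZv. Qed.

Lemma smooth0_push v K : smooth0 K -> smooth0 (push v K).
Proof.
move=> sK; have op := @open_neq0 R n.
exact (smooth_onD op (smooth0_dir v sK)
  (smooth_onM op (smooth0_slope v) (smooth0_dir x sK))).
Qed.

Lemma is_derive_comp_xi K y v : smooth0 K -> y != 0 ->
  is_derive y v (K \o xi) (push v K (xi y)).
Proof.
move=> sK y0; rewrite push_dir; apply: is_derive_along.
have dc : is_derive (0 : R) 1 (fun s : R => xi (y + s *: v)) (v + slope v (xi
  y) *: x).
  have dP : is_derive (0 : R) 1 (fun s : R => Psol phi x (y + s *: v)) (slope v
    (xi y)).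
    have [d1 <-] := is_derive_Psol v y0.
    have := @is_derive_line R _ (Psol phi x) y v 0.
    by rewrite scale0r addr0; apply.
  have d1 := is_derive_scalel x dP.
  have d2 := is_derive_scalel v (is_derive_id (0 : R) 1).
  have := is_deriveD (is_deriveD (is_derive_cst y (0 : R) 1) d2) d1.
  by rewrite add0r scale1r.
have := is_derive_chain sK _ dc.
by rewrite scale0r addr0; apply; exact: xi_neq0.
Qed.

Lemma xi_continuous y : {for y, continuous xi}.
Proof.
have [C C0 HC] := Psol_lipschitz.
have cP : Psol phi x z @[z --> y] --> Psol phi x y.
  apply/(@cvgrPdist_le _ _ _ (nbhs y)) => e e0.
  have e1 : 0 < e / (C + 1) by rewrite divr_gt0// ltr_wpDl.
  near=> z.
  have zy : `|y - z| <= e / (C + 1).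
    near: z; exact: (@cvgr_dist_le _ _ _ (nbhs y) _ id y cvg_id _ e1).
  apply: le_trans (HC _ _) _; apply: le_trans (ler_wpM2l C0 zy) _.
  by rewrite mulrCA ger_pMr// ler_pdivrMr ?ltr_wpDl// mul1r lerDl.
have cPx : Psol phi x z *: x @[z --> y] --> Psol phi x y *: x.
  exact: cvgZr_tmp cP.
have cy : z @[z --> y] --> y by exact: cvg_id.
exact: (cvgD cy cPx).
Unshelve. all: by end_near. Qed.

Lemma comp_xi_continuous K y : smooth0 K -> y != 0 -> {for y,
  continuous (K \o xi)}.
Proof.
move=> sK y0; apply: continuous_comp; first exact: xi_continuous.
exact: smooth_on_continuous sK (xi_neq0 y0).
Qed.

(** The induction on the order generalises over [K]: a partial derivative of [K \o xi] is
    [push _ K \o xi], and [push _ K] is smooth again. *)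
Lemma smooth0_comp_xi K : smooth0 K -> smooth0 (K \o xi).
Proof.
move=> sK; apply/smooth_onP => k; elim: k K sK => [|k IH] K sK.
  by split; [move=> y y0; exact: comp_xi_continuous|].
split; first by move=> y y0; exact: comp_xi_continuous.
split=> [y y0 i|i]; first by have [] := is_derive_comp_xi (delta_mx 0 i) sK y0.
apply: (Ck_eq (@open_neq0 R n) _ (IH _ (smooth0_push (delta_mx 0 i) sK))) =>
  y y0.
have [_ E] := is_derive_comp_xi (delta_mx 0 i) sK y0.
by rewrite /partial E.
Qed.

Lemma dir_comp_xi K y v : smooth0 K -> y != 0 ->
  dir v (K \o xi) y = push v K (xi y).
Proof.
move=> sK y0; rewrite (dirE (@open_neq0 R n) _ (smooth0_comp_xi sK) y0).
by have [_ ->] := is_derive_comp_xi v sK y0.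
Qed.

End FunkChange.

(** * The second derivatives of [F] *)

Section SecondDerivatives.
Variables (R : realType) (n : nat).
Implicit Types (f K : 'rV[R]_n -> R) (x z u v V : 'rV[R]_n).

Let op := @open_neq0 R n.

Lemma dir_ext f g z v : z != 0 -> (forall w : 'rV[R]_n, w != 0 -> f w = g w) ->
  dir v f z = dir v g z.
Proof. by move=> z0 fg; apply: (dir_eq op v z0) => w; exact: fg. Qed.

Lemma dir2Dr K u v w (s : R) z : smooth0 K -> z != 0 ->
  dir u (dir (v + s *: w) K) z = dir u (dir v K) z + s * dir u (dir w K) z.
Proof.
move=> sK z0; have sv := smooth0_dir v sK; have sw := smooth0_dir w sK.
rewrite (@dir_ext _ (fun p => dir v K p + s * dir w K p) _ _ z0); last first.
  by move=> p p0; rewrite dirDv dirZv.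
rewrite (dirD op u sv (smooth_onM op (@smooth_on_cst R n _ s) sw) z0).
by rewrite (dirZ op _ _ sw z0).
Qed.

Section OnePoint.
Variables (psi phi : 'rV[R]_n -> R) (x : 'rV[R]_n).
Hypothesis phiP : pseudo_norm phi.
Hypothesis phi_smooth : smooth0 phi.
Hypothesis psi_smooth : smooth0 psi.
Hypothesis x_Omega : Omega phi x.

Let b z := (den phi x z)^-1.

Let smooth_b : smooth0 b.
Proof. exact: smooth0_denV. Qed.

Lemma dir_denV v z : z != 0 ->
  dir v (fun w => (den phi x w)^-1) z
  = (den phi x z)^-1 ^+ 2 * dir v (dir x phi) z.
Proof.
move=> z0; have d0 w : w != 0 -> den phi x w != 0.
  by move=> w0; rewrite gt_eqF// (den_gt0 phiP).
rewrite (dirV op v d0 (smooth0_den x phi_smooth) z0).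
have sx := smooth0_dir x phi_smooth.
rewrite (@dir_ext (den phi x) (fun w => 1 + (-1) * dir x phi w) _ _ z0);
  last first.
  by move=> w w0; rewrite mulN1r.
rewrite (dirD op v (@smooth_on_cst R n _ 1) (smooth_onM op (@smooth_on_cst R n
  _ (-1)) sx) z0).
rewrite dir_cst (dirZ op _ _ sx z0).
by move: (_^-1) (dir v _ z) => a c; ring.
Qed.

(** The derivative of [slope] along [V] collapses to [phi_VV / den], which is the second derivative
    of [P]; this accounts for the last term. *)
Lemma push2 K v z : smooth0 K -> z != 0 ->
  let V := v + slope phi x v z *: x in
  push phi x v (push phi x v K) z
  = dir V (dir V K) z + dir V (dir V phi) z / den phi x z * dir x K z.
Proof.
move=> sK z0 V; rewrite push_dir -/V.
have sv := smooth0_dir v sK; have sx := smooth0_dir x sK.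
have ss := smooth0_slope phiP phi_smooth x_Omega v.
have sp := smooth0_dir v phi_smooth.
have -> : dir V (push phi x v K) z = dir V (dir v K) z
    + (dir V (slope phi x v) z * dir x K z + slope phi x v z * dir V (dir x K)
      z).
  rewrite -(dirM op V ss sx z0).
  exact: (dirD op V sv (smooth_onM op ss sx) z0).
have -> : dir V (slope phi x v) z = dir V (dir v phi) z * (den phi x z)^-1
    + dir v phi z * ((den phi x z)^-1 ^+ 2 * dir V (dir x phi) z).
  by rewrite -(dir_denV V z0); exact: (dirM op V sp smooth_b z0).
have E2 f : smooth0 f -> dir V (dir V f) z
    = dir V (dir v f) z + slope phi x v z * dir V (dir x f) z.
  by move=> sf; exact: dir2Dr.
rewrite (E2 _ sK) (E2 _ phi_smooth) /slope.
move: (dir V (dir v K) z) (dir V (dir x K) z) (dir x K z) (dir V (dir v phi) z)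
  (dir V (dir x phi) z) (dir v phi z) => a1 a2 a3 a4 a5 a6.
move: (den phi x z)^-1 => d; ring.
Qed.

(* [Fmetric psi phi x] is [hfun] read through [xi]. *)
Definition hfun z := psi z * b z.

Definition hfun1 V z := dir V psi z * b z + psi z * (b z ^+ 2 * dir V (dir x
  phi) z).

(* The second derivative of [F] along [v] at [y], for [z = xi y] and
   [V = v + slope v z x] the derivative of [xi] along [v]. *)
Definition gform V z := dir V (dir V psi) z * b z
  + 2 * dir V psi z * b z ^+ 2 * dir V (dir x phi) z
  + psi z * (2 * b z ^+ 3 * dir V (dir x phi) z ^+ 2
             + b z ^+ 2 * dir V (dir V (dir x phi)) z)
  + dir V (dir V phi) z * b z
    * (dir x psi z * b z + psi z * b z ^+ 2 * dir x (dir x phi) z).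

Lemma smooth0_hfun : smooth0 hfun.
Proof. exact (smooth_onM op psi_smooth smooth_b). Qed.

Lemma dir_hfun V z : z != 0 -> dir V hfun z = hfun1 V z.
Proof.
move=> z0; rewrite /hfun1 -(dir_denV V z0).
exact: (dirM op V psi_smooth smooth_b z0).
Qed.

Lemma push2_hfun v z : z != 0 ->
  push phi x v (push phi x v hfun) z = gform (v + slope phi x v z *: x) z.
Proof.
move=> z0; rewrite (push2 v smooth0_hfun z0) /=.
move: (v + _ *: x) => V; rewrite (dir_hfun x z0).
have sVp := smooth0_dir V psi_smooth; have sx := smooth0_dir x phi_smooth.
have sVx := smooth0_dir V sx.
have sbb := smooth_onM op smooth_b (smooth_onM op smooth_b sVx).
rewrite (@dir_ext (dir V hfun)
  (fun w => dir V psi w * b w + psi w * (b w * (b w * dir V (dir x phi) w))) _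
    _ z0); last first.
  move=> w w0; rewrite (dir_hfun V w0) /hfun1.
  by move: (b w) (dir _ _ _) (dir _ _ _) (psi w) => ? ? ? ?; ring.
rewrite (dirD op V (smooth_onM op sVp smooth_b) (smooth_onM op psi_smooth sbb)
  z0).
rewrite (dirM op V sVp smooth_b z0) (dirM op V psi_smooth sbb z0).
rewrite (dirM op V smooth_b (smooth_onM op smooth_b sVx) z0).
rewrite (dirM op V smooth_b sVx z0) /b !(dir_denV V z0) /gform /hfun1 /b.
move: (dir V (dir V psi) z) (dir V psi z) (dir x psi z) (psi z) => a1 a2 a3 a4.
move: (dir V (dir V (dir x phi)) z) (dir V (dir x phi) z) (dir x (dir x phi) z)
  => a5 a6 a7.
move: (dir V (dir V phi) z) (den phi x z)^-1 => a8 d; ring.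
Qed.

Hypothesis psiP : pseudo_norm psi.

(** The second factor of [F] is [1 + phi_x / (1 - phi_x) = 1 / den], evaluated at [xi]. *)
Lemma FmetricE y : y != 0 -> Fmetric psi phi x y = (hfun \o xi phi x) y.
Proof.
move=> y0; rewrite /Fmetric -/(xi phi x y) /hfun /b /=; congr (_ * _).
have dz := den_gt0 phiP phi_smooth x_Omega (xi_neq0 phiP x_Omega y0).
have -> : \sum_k x 0 k * partial k (Psol phi x) y = slope phi x x (xi phi x y).
  have E k : partial k (Psol phi x) y = partial k phi (xi phi x y) / den phi x
    (xi phi x y).
    have [_ E] := is_derive_Psol phiP phi_smooth x_Omega (delta_mx 0 k) y0.
    by rewrite /partial E /slope dir_delta.
  under eq_bigr do rewrite E mulrA.
  by rewrite -mulr_suml.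
rewrite /slope; move: dz; rewrite /den; move: (dir x phi _) => a a0.
by field; rewrite gt_eqF.
Qed.

End OnePoint.
End SecondDerivatives.

(** * Euler identities for the derivatives of a pseudo-norm up to order three *)

Section Transformations.
Variables (R : realType) (n : nat) (phi : 'rV[R]_n -> R).
Hypothesis phiP : pseudo_norm phi.
Hypothesis phi_smooth : smooth0 phi.
Implicit Types (z u v w : 'rV[R]_n) (l : R).

Let op := @open_neq0 R n.

Let homog1 : homog id phi.
Proof. by move=> l z l0 _; exact: (pn_homo phiP). Qed.

Lemma pn_dirZ l z v : 0 < l -> z != 0 -> dir v phi (l *: z) = dir v phi z.
Proof.
move=> l0 z0; rewrite (homog_dir v phi_smooth homog1 l0 z0).
by rewrite divff ?mul1r ?gt_eqF.
Qed.

Lemma pn_dir2Z l z u v : 0 < l -> z != 0 ->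
  dir u (dir v phi) (l *: z) = l^-1 * dir u (dir v phi) z.
Proof.
move=> l0 z0; have sv := smooth0_dir v phi_smooth.
have hv : homog (fun=> 1) (dir v phi) by move=> k w k0 w0;
  rewrite mul1r pn_dirZ.
by rewrite (homog_dir u sv hv l0 z0) div1r.
Qed.

Lemma pn_dir3Z l z u v w : 0 < l -> z != 0 ->
  dir w (dir u (dir v phi)) (l *: z) = l^-1 ^+ 2 * dir w (dir u (dir v phi)) z.
Proof.
move=> l0 z0; have suv := smooth0_dir u (smooth0_dir v phi_smooth).
have hv : homog (fun l => l^-1) (dir u (dir v phi)) by move=> k p k0 p0;
  exact: pn_dir2Z.
by rewrite (homog_dir w suv hv l0 z0) expr2.
Qed.

Lemma pn_dir_id z : z != 0 -> dir z phi z = phi z.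
Proof. exact: (dir_homo1 (pn_homo phiP) phi_smooth). Qed.

Lemma pn_dir2_id z v : z != 0 -> dir z (dir v phi) z = 0.
Proof. exact: (dir2_homo1 (pn_homo phiP) phi_smooth). Qed.

Lemma pn_dir2_idr z v : z != 0 -> dir v (dir z phi) z = 0.
Proof. by move=> z0; rewrite (dir_comm op v z phi_smooth z0) pn_dir2_id. Qed.

Lemma pn_dir3_id z u v : z != 0 ->
  dir z (dir u (dir v phi)) z = - dir u (dir v phi) z.
Proof.
move=> z0; have suv := smooth0_dir u (smooth0_dir v phi_smooth).
have hv : homog (fun l => l^-1) (dir u (dir v phi)) by move=> k p k0 p0;
  exact: pn_dir2Z.
have dc : is_derive (0 : R) 1 (fun s : R => (1 + s)^-1) (-1).
  have d1 : is_derive (0 : R) 1 (fun s : R => 1 + s) 1.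
    have := is_deriveD (is_derive_cst (1 : R) (0 : R) 1) (is_derive_id (0 : R)
      1).
    by rewrite add0r.
  have n0 : (1 : R) + 0 != 0 by rewrite addr0 oner_neq0.
  have [dd dE] := d1; apply: DeriveDef; first exact: derivableV n0 dd.
  by rewrite (deriveV n0 dd) dE addr0 expr1n invr1 scaleNr scale1r.
by rewrite (euler suv hv z0 dc) mulN1r.
Qed.

Lemma pn_dir3_idr z u v : z != 0 ->
  dir u (dir v (dir z phi)) z = - dir u (dir v phi) z.
Proof.
move=> z0; rewrite -(pn_dir3_id u v z0).
have sv := smooth0_dir v phi_smooth.
rewrite (dir_comm op z u sv z0).
by apply: (dir_ext u z0) => w w0; exact: (dir_comm op v z phi_smooth w0).
Qed.

Lemma dirDr f u v w (s t : R) z : smooth0 f -> z != 0 ->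
  dir u (dir (s *: v + t *: w) f) z = s * dir u (dir v f) z + t * dir u (dir w
    f) z.
Proof.
move=> sf z0; rewrite (dir2Dr u _ _ t sf z0); congr (_ + _).
rewrite -(dirZ op s u (smooth0_dir v sf) z0).
by apply: (dir_ext u z0) => p _; exact: dirZv.
Qed.

End Transformations.

(** * Behaviour of [gform] under scalings and shifts *)

Section FormInvariance.
Variables (R : realType) (n : nat) (psi phi : 'rV[R]_n -> R).
Hypothesis phiP : pseudo_norm phi.
Hypothesis phi_smooth : smooth0 phi.
Hypothesis psiP : pseudo_norm psi.
Hypothesis psi_smooth : smooth0 psi.
Implicit Types (x z u v w : 'rV[R]_n) (l : R).

Let op := @open_neq0 R n.

Lemma den_scale l x z : 0 < l -> z != 0 -> den phi x (l *: z) = den phi x z.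
Proof. by move=> l0 z0; rewrite /den pn_dirZ. Qed.

Lemma gform_scale l x V z : 0 < l -> z != 0 ->
  gform psi phi x V (l *: z) = l^-1 * gform psi phi x V z.
Proof.
move=> l0 z0; rewrite /gform den_scale//.
rewrite (pn_dir2Z phiP phi_smooth V V l0 z0) (pn_dir2Z psiP psi_smooth V V l0
  z0).
rewrite (pn_dir2Z phiP phi_smooth V x l0 z0) (pn_dir2Z phiP phi_smooth x x l0
  z0).
rewrite (pn_dir3Z phiP phi_smooth V x V l0 z0).
rewrite (pn_dirZ psiP psi_smooth V l0 z0) (pn_dirZ psiP psi_smooth x l0 z0).
rewrite (pn_homo psiP _ l0).
move: (dir V (dir V psi) z) (dir V psi z) (dir x psi z) (psi z) => a1 a2 a3 a4.
move: (dir V (dir V (dir x phi)) z) (dir V (dir x phi) z) (dir x (dir x phi) z)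
  => a5 a6 a7.
move: (dir V (dir V phi) z) (den phi x z)^-1 => a8 d; field; exact: lt0r_neq0.
Qed.

(** By homogeneity [xi] has derivative [xi] along [y], so this is the kernel property of [y] in the
    new variables. In the formula, the term [2 c psi b^2 phi_Vx] coming from [dir V psi] cancels
    against the third derivative of [phi], by Euler's identity in degree -1. *)
Lemma gform_addV x V z (c : R) : z != 0 ->
  gform psi phi x (V + c *: z) z = gform psi phi x V z.
Proof.
move=> z0; rewrite /gform.
have EV K : smooth0 K -> dir (V + c *: z) (dir (V + c *: z) K) z
    = dir V (dir V K) z + c * dir V (dir z K) z
      + c * (dir z (dir V K) z + c * dir z (dir z K) z).
  by move=> sK; rewrite dirDv dirZv !(dir2Dr _ _ _ _ sK z0).
have sx := smooth0_dir x phi_smooth.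
rewrite (EV _ psi_smooth) (EV _ phi_smooth) (EV _ sx).
rewrite !(dirDv, dirZv).
rewrite (pn_dir_id psiP psi_smooth z0).
rewrite (pn_dir2_id psiP psi_smooth V z0) (pn_dir2_id psiP psi_smooth z z0).
rewrite (pn_dir2_idr psiP psi_smooth V z0).
rewrite (pn_dir2_id phiP phi_smooth V z0) (pn_dir2_id phiP phi_smooth z z0).
rewrite (pn_dir2_idr phiP phi_smooth V z0) (pn_dir2_id phiP phi_smooth x z0).
rewrite (pn_dir3_id phiP phi_smooth V x z0) (pn_dir3_id phiP phi_smooth z x z0).
rewrite (dir_comm op V z sx z0) (pn_dir3_id phiP phi_smooth V x z0).
rewrite (pn_dir2_id phiP phi_smooth x z0).
move: (dir V (dir V psi) z) (dir V psi z) (dir x psi z) (psi z) => a1 a2 a3 a4.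
move: (dir V (dir V (dir x phi)) z) (dir V (dir x phi) z) (dir x (dir x phi) z)
  => a5 a6 a7.
move: (dir V (dir V phi) z) (den phi x z)^-1 => a8 d; ring.
Qed.

Section Shift.
Variables (x z : 'rV[R]_n) (l t : R).
Hypothesis l_gt0 : 0 < l.
Hypothesis z_neq0 : z != 0.
Hypothesis l_def : l^-1 = 1 - t * phi z.

(** This is [x + t y] for [y = z - phi z *: x]. *)
Let x' := l^-1 *: x + t *: z.

Lemma den_shift : den phi x' z = l^-1 * den phi x z.
Proof.
rewrite /den dirDv !dirZv (pn_dir_id phiP phi_smooth z_neq0).
by rewrite mulrBr mulr1 {2}l_def opprD addrA addrAC; reflexivity.
Qed.

(** Adding [t z] to the base point leaves two extra terms: [- t phi_VV] in the third derivative of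
    [phi], and [t psi] in [dir x' psi]. They enter [gform] with the same weight and cancel; what
    remains is a rescaling. *)
Lemma gform_shift V : gform psi phi x' V z = l * gform psi phi x V z.
Proof.
have sx := smooth0_dir x phi_smooth; have sz := smooth0_dir z phi_smooth.
have E1 u : dir u (dir x' phi) z = l^-1 * dir u (dir x phi) z.
  rewrite (dirDr u x z l^-1 t phi_smooth z_neq0).
  by rewrite (pn_dir2_idr phiP phi_smooth u z_neq0) mulr0 addr0; reflexivity.
have E2 : dir V (dir V (dir x' phi)) z
    = l^-1 * dir V (dir V (dir x phi)) z - t * dir V (dir V phi) z.
  have sVx := smooth0_dir V sx; have sVz := smooth0_dir V sz.
  have cM (c : R) f (sf : smooth0 f) := smooth_onM op (@smooth_on_cst R n _ c)
    sf.
  rewrite (@dir_ext _ _ _ (fun w => l^-1 * dir V (dir x phi) w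
     + t * dir V (dir z phi) w) _ _ z_neq0); last first.
    by move=> w w0; exact: dirDr.
  rewrite (dirD op V (cM _ _ sVx) (cM _ _ sVz) z_neq0).
  rewrite (dirZ op _ _ sVx z_neq0) (dirZ op _ _ sVz z_neq0).
  by rewrite (pn_dir3_idr phiP phi_smooth V V z_neq0) mulrN; reflexivity.
have E3 : dir x' (dir x' phi) z = l^-1 ^+ 2 * dir x (dir x phi) z.
  rewrite E1 dirDv !dirZv (pn_dir2_id phiP phi_smooth x z_neq0) mulr0 addr0
    mulrA.
  by rewrite -expr2; reflexivity.
have E4 : dir x' psi z = l^-1 * dir x psi z + t * psi z.
  by rewrite dirDv !dirZv (pn_dir_id psiP psi_smooth z_neq0); reflexivity.
rewrite /gform den_shift E3 E2 E4 (E1 V).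
have l0 : l != 0 by rewrite gt_eqF.
rewrite invfM invrK.
move: (dir V (dir V psi) z) (dir V psi z) (dir x psi z) (psi z) => a1 a2 a3 a4.
move: (dir V (dir V (dir x phi)) z) (dir V (dir x phi) z) (dir x (dir x phi) z)
  => a5 a6 a7.
move: (dir V (dir V phi) z) (den phi x z)^-1 => a8 d.
by field.
Qed.

End Shift.

Lemma gform_scaleV x z V (l : R) : z != 0 ->
  gform psi phi x (l *: V) z = l ^+ 2 * gform psi phi x V z.
Proof.
move=> z0; rewrite /gform.
have EV K : smooth0 K -> dir (l *: V) (dir (l *: V) K) z = l ^+ 2 * dir V (dir
  V K) z.
  move=> sK; rewrite dirZv expr2 -mulrA; congr (_ * _).
  rewrite -(dirZ op l V (smooth0_dir V sK) z0).
  by apply: (dir_ext V z0) => p _; exact: dirZv.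
rewrite (EV _ psi_smooth) (EV _ phi_smooth) (EV _ (smooth0_dir x phi_smooth))
  !dirZv.
move: (dir V (dir V psi) z) (dir V psi z) (dir x psi z) (psi z) => a1 a2 a3 a4.
move: (dir V (dir V (dir x phi)) z) (dir V (dir x phi) z) (dir x (dir x phi) z)
  => a5 a6 a7.
move: (dir V (dir V phi) z) (den phi x z)^-1 => a8 d; ring.
Qed.

(* Half the Hessian form of [F^2], in the variables of [gform]. *)
Definition formxi x z V :=
  hfun1 psi phi x V z ^+ 2 + hfun psi phi x z * gform psi phi x V z.

Lemma formxi_scaleV x z V (l : R) : z != 0 ->
  formxi x z (l *: V) = l ^+ 2 * formxi x z V.
Proof.
move=> z0; rewrite /formxi (gform_scaleV _ _ _ z0) /hfun1 !dirZv.
move: (dir V psi z) (dir V (dir x phi) z) (gform psi phi x V z) => a1 a2 a3.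
move: (psi z) (den phi x z)^-1 (hfun psi phi x z) => a4 d a5; ring.
Qed.

Lemma formxi_scale x z V (l : R) : 0 < l -> z != 0 ->
  formxi x (l *: z) V = formxi x z V.
Proof.
move=> l0 z0; rewrite /formxi (gform_scale _ _ l0 z0) /hfun1 /hfun den_scale//.
rewrite (pn_dir2Z phiP phi_smooth V x l0 z0) (pn_dirZ psiP psi_smooth V l0 z0).
rewrite (pn_homo psiP _ l0).
move: (dir V psi z) (dir V (dir x phi) z) (gform psi phi x V z) => a1 a2 a3.
move: (psi z) (den phi x z)^-1 => a4 d; field; exact: lt0r_neq0.
Qed.

End FormInvariance.

(** * [F] and its Hessian in the variables [xi] and [V] *)

Section FmetricDerivatives.
Variables (R : realType) (n : nat) (psi phi : 'rV[R]_n -> R).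
Hypothesis phiP : pseudo_norm phi.
Hypothesis phi_smooth : smooth0 phi.
Hypothesis psiP : pseudo_norm psi.
Hypothesis psi_smooth : smooth0 psi.
Implicit Types (x y z u v w V : 'rV[R]_n).

Let op := @open_neq0 R n.
Local Notation F := (Fmetric psi phi).
Local Notation xi := (xi phi).

Section BasePoint.
Variable x : 'rV[R]_n.
Hypothesis x_Omega : Omega phi x.

Let smooth_h : smooth0 (hfun psi phi x).
Proof. exact: smooth0_hfun. Qed.

Lemma smooth0_Fmetric : smooth0 (F x).
Proof.
apply: (smooth_on_eq op _ (smooth0_comp_xi phiP phi_smooth x_Omega smooth_h))
  => y y0.
by rewrite (FmetricE psi phiP phi_smooth x_Omega y0).
Qed.

Definition vxi y v := v + slope phi x v (xi x y) *: x.

Lemma dir_Fmetric y v : y != 0 -> dir v (F x) y = hfun1 psi phi x (vxi y v) (xi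
  x y).
Proof.
move=> y0; rewrite (dir_ext v y0 (FmetricE psi phiP phi_smooth x_Omega)).
rewrite (dir_comp_xi phiP phi_smooth x_Omega v smooth_h y0) push_dir.
exact: (dir_hfun phiP phi_smooth psi_smooth x_Omega _ (xi_neq0 phiP x_Omega
  y0)).
Qed.

Lemma dir2_Fmetric y v : y != 0 ->
  dir v (dir v (F x)) y = gform psi phi x (vxi y v) (xi x y).
Proof.
move=> y0; have sp := smooth0_push phiP phi_smooth x_Omega v smooth_h.
rewrite (@dir_ext _ _ _ (push phi x v (hfun psi phi x) \o xi x) _ _ y0);
  last first.
  move=> w w0; rewrite (dir_ext v w0 (FmetricE psi phiP phi_smooth x_Omega)).
  exact: (dir_comp_xi phiP phi_smooth x_Omega v smooth_h w0).
rewrite (dir_comp_xi phiP phi_smooth x_Omega v sp y0).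
exact: (push2_hfun phiP phi_smooth psi_smooth x_Omega v (xi_neq0 phiP x_Omega
  y0)).
Qed.

Lemma Fmetric0 : F x 0 = 0.
Proof. by rewrite /Fmetric -/(xi x 0) (xi0 phiP x_Omega) (pseudo_norm0 psiP)
  mul0r. Qed.

Lemma Fmetric_gt0 y : y != 0 -> 0 < F x y.
Proof.
move=> y0; have z0 := xi_neq0 phiP x_Omega y0.
rewrite (FmetricE psi phiP phi_smooth x_Omega y0) /hfun /= divr_gt0//.
  exact: pseudo_norm_gt0.
exact: den_gt0.
Qed.

Lemma Fmetric_ge0 y : 0 <= F x y.
Proof. by have [->|/Fmetric_gt0/ltW//] := eqVneq y 0; rewrite Fmetric0. Qed.

Lemma Fmetric_eq0 y : F x y = 0 <-> y = 0.
Proof.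
split=> [Fy|->]; last exact: Fmetric0.
by apply/eqP/negP => /negP/Fmetric_gt0; rewrite Fy ltxx.
Qed.

Lemma Fmetric_homo (a : R) y : 0 < a -> F x (a *: y) = a * F x y.
Proof.
move=> a0; have [->|y0] := eqVneq y 0; first by rewrite scaler0 Fmetric0 mulr0.
have ay0 : a *: y != 0 by rewrite scaler_eq0 negb_or y0 gt_eqF.
have z0 := xi_neq0 phiP x_Omega y0.
rewrite !(FmetricE psi phiP phi_smooth x_Omega)//= /hfun xi_homog// den_scale//.
by rewrite (pn_homo psiP)// mulrA.
Qed.

Lemma posdef_FmetricP y : y != 0 -> posdef (hessian (fun z => F x z ^+ 2) y) <->
  forall v, ~ parallel y v -> 0 < dir v (dir v (F x)) y.
Proof.
exact: (posdef_sqrP Fmetric_ge0 Fmetric_eq0 Fmetric_homo smooth0_Fmetric).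
Qed.

Lemma hessian_FmetricE y v : y != 0 ->
  \sum_i \sum_j hessian (fun z => F x z ^+ 2) y i j * v 0 i * v 0 j
  = 2 * (dir v (F x) y ^+ 2 + F x y * dir v (dir v (F x)) y).
Proof. exact: (hessian_sqrE smooth0_Fmetric). Qed.

Lemma hessian_formxi y v : y != 0 ->
  \sum_i \sum_j hessian (fun z => F x z ^+ 2) y i j * v 0 i * v 0 j
  = 2 * formxi psi phi x (xi x y) (vxi y v).
Proof.
move=> y0; rewrite (hessian_FmetricE _ y0) (dir_Fmetric _ y0) (dir2_Fmetric _
  y0).
by rewrite (FmetricE psi phiP phi_smooth x_Omega y0).
Qed.

(** The slope can be read off [V], since [phi_V = phi_v + slope * phi_x = slope]; hence the passage
    from [v] to [V] is invertible. *)
Lemma vxi_inv y V : y != 0 -> vxi y (V - dir V phi (xi x y) *: x) = V.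
Proof.
move=> y0; have z0 := xi_neq0 phiP x_Omega y0.
have := den_gt0 phiP phi_smooth x_Omega z0.
rewrite /vxi /slope -scaleNr dirDv dirZv /den.
move: (dir V phi _) (dir x phi _) => a c c0.
rewrite -addrA -scalerDl (_ : _ + _ / _ = 0) ?scale0r ?addr0//.
by field; rewrite gt_eqF.
Qed.

Lemma vxi_cancel y v : y != 0 -> v = vxi y v - dir (vxi y v) phi (xi x y) *: x.
Proof.
move=> y0; have z0 := xi_neq0 phiP x_Omega y0.
have := den_gt0 phiP phi_smooth x_Omega z0.
rewrite /vxi /slope dirDv dirZv /den.
move: (dir v phi _) (dir x phi _) => a c c0.
rewrite -addrA -scalerBl (_ : _ - _ = 0) ?scale0r ?addr0//.
by field; rewrite gt_eqF.
Qed.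

Lemma vxi0 y : vxi y 0 = 0.
Proof.
by rewrite /vxi /slope dir0v mul0r scale0r addr0.
Qed.

(** Both changes of variables are bijective on nonzero vectors, so the condition ranges over pairs
    independent of [x]. The norm axioms come from [elliptic_minkowski]. *)
Lemma Oset_formxiP : Oset psi phi x <->
  forall z V, z != 0 -> V != 0 -> 0 < formxi psi phi x z V.
Proof.
split=> [[_ mF] z V z0 V0|H].
  pose y := z - phi z *: x.
  have zE : xi x y = z by exact: xi_inv.
  have y0 : y != 0 by apply: contraNneq z0 => y0; rewrite -zE y0 (xi0 phiP
    x_Omega).
  pose v := V - dir V phi z *: x.
  have VE : vxi y v = V by rewrite /v -zE vxi_inv.
  have v0 : v != 0 by apply: contraNneq V0 => v0; rewrite -VE v0 vxi0.
  have := mk_posdef mF y0 v0.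
  by rewrite (hessian_formxi _ y0) VE zE pmulr_rgt0.
split; first exact: x_Omega.
apply: (elliptic_minkowski Fmetric_ge0 Fmetric_eq0 Fmetric_homo
  smooth0_Fmetric).
move=> y y0 v v0; rewrite (hessian_formxi _ y0) pmulr_rgt0//; apply: H.
  exact: xi_neq0.
apply: contraNneq v0 => V0.
by rewrite (vxi_cancel v y0) V0 dir0v scale0r subr0.
Qed.

End BasePoint.

Section Line.
Variables (x y : 'rV[R]_n) (t : R).
Hypothesis y_neq0 : y != 0.
Hypothesis x_Omega : Omega phi x.
Hypothesis xty_Omega : Omega phi (x + t *: y).

(* Moving the base point along y rescales [xi] by a factor [l] and adds a
   multiple of [xi] to the transported vectors; neither changes [gform]. *)
Lemma dir2_Fmetric_line v :
  dir v (dir v (F (x + t *: y))) y = dir v (dir v (F x)) y.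
Proof.
have z0 := xi_neq0 phiP x_Omega y_neq0.
set z := xi x y in z0; set q := Psol phi x y.
have qE : q = phi z by exact: Psol_xi.
have yE : y = z - q *: x by rewrite /z /xi addrK.
have dz := den_gt0 phiP phi_smooth x_Omega z0.
(* The denominators at the base points [x] and [x + t y] are both positive, and [1 - t * q] is their
   ratio. *)
have k0 : 0 < 1 - t * q.
  have := den_gt0 phiP phi_smooth xty_Omega z0.
  have -> : den phi (x + t *: y) z = (1 - t * q) * den phi x z.
    rewrite /den dirDv dirZv {1}yE -scaleNr dirDv dirZv (pn_dir_id phiP
      phi_smooth z0) -qE.
    by move: (dir x phi z) => a; ring.
  by rewrite pmulr_lgt0.
pose l := (1 - t * q)^-1.
have l0 : 0 < l by rewrite invr_gt0.
have lV : l^-1 = 1 - t * q by rewrite invrK.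
have xE : x + t *: y = l^-1 *: x + t *: z.
  by rewrite lV {1}yE scalerBr scalerBl scale1r scalerA addrA addrAC.
have lE : l = 1 + l * q * t.
  have : l * (1 - t * q) = 1 by rewrite mulVf// gt_eqF.
  by move=> e; rewrite -[X in X + _]e; ring.
have x'E : y + (l * q) *: (x + t *: y) = l *: z.
  have zE : z = y + q *: x by [].
  by rewrite zE !scalerDr !scalerA {3}lE scalerDl scale1r addrAC addrA.
(* [l * q] solves the equation for the new base point, since [phi (l *: z) = l * q]. *)
have PE : Psol phi (x + t *: y) y = l * q.
  by apply/esym/(Psol_unique phiP xty_Omega); rewrite x'E (pn_homo phiP _ l0)
    -qE.
have xiE : xi (x + t *: y) y = l *: z by rewrite /xi PE x'E.
have lz0 : l *: z != 0 by rewrite scaler_eq0 negb_or gt_eqF.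
have lVz : l^-1 = 1 - t * phi z by rewrite -qE.
apply: (etrans (dir2_Fmetric xty_Omega v y_neq0)).
apply: (etrans _ (esym (dir2_Fmetric x_Omega v y_neq0))).
rewrite xiE -/z.
have -> : vxi (x + t *: y) y v
    = vxi x y v + (slope phi x v z * l * t) *: z.
  rewrite /vxi xiE /slope (den_scale phiP phi_smooth _ l0 z0).
  rewrite (pn_dirZ phiP phi_smooth v l0 z0) xE (den_shift phiP phi_smooth x z0
    lVz).
  rewrite -/z -addrA; congr (_ + _); rewrite scalerDr !scalerA invfM invrK.
  move: (dir v phi z) (den phi x z)^-1 => a d; congr (_ *: _ + _ *: _);
    last by ring.
  by field; rewrite gt_eqF.
rewrite xE (gform_scale phiP phi_smooth psiP psi_smooth _ _ l0 z0).
rewrite (gform_shift phiP phi_smooth psiP psi_smooth x l0 z0 lVz).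
rewrite (gform_addV phiP phi_smooth psiP psi_smooth _ _ _ z0).
by rewrite mulrA mulVf ?mul1r ?gt_eqF.
Qed.

End Line.
End FmetricDerivatives.

(** * Openness of [Oset] *)

Section JointContinuity.
Variables (R : realType) (n : nat) (T : Type) (F : set_system T).
Context {FF : Filter F}.
Variables (X Z V : T -> 'rV[R]_n) (x0 z0 V0 : 'rV[R]_n).
Hypothesis cX : X t @[t --> F] --> x0.
Hypothesis cZ : Z t @[t --> F] --> z0.
Hypothesis cV : V t @[t --> F] --> V0.
Hypothesis z0_neq0 : z0 != 0.
Implicit Types (f : 'rV[R]_n -> R) (W : T -> 'rV[R]_n) (w : 'rV[R]_n).

Let op := @open_neq0 R n.

Lemma cvg_expr (g : T -> R) (a : R) k :
  g t @[t --> F] --> a -> g t ^+ k @[t --> F] --> a ^+ k.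
Proof.
move=> ga; elim: k => [|k IH]; first exact: cvg_cst.
under eq_cvg do rewrite exprS.
by rewrite exprS; exact: cvgM ga IH.
Qed.

Lemma cvg_smooth0 f : smooth0 f -> f (Z t) @[t --> F] --> f z0.
Proof. by move=> sf; exact: (continuous_cvg _ (smooth_on_continuous sf z0_neq0)
  cZ). Qed.

Lemma cvg_coordinate W w i : W t @[t --> F] --> w -> W t 0 i @[t --> F] -->
  w 0 i.
Proof. by move=> cW; exact: (continuous_cvg _ (@coord_continuous R 1 n 0 i w)
  cW). Qed.

(** The direction moves together with the point; expanding in coordinates leaves fixed functions
    [partial i f] at a moving point. *)
Lemma cvg_dir f W w : smooth0 f -> W t @[t --> F] --> w ->
  dir (W t) f (Z t) @[t --> F] --> dir w f z0.
Proof.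
move=> sf cW.
change (\sum_i W t 0 i * partial i f (Z t) @[t --> F] -->
  \sum_i w 0 i * partial i f z0).
apply: cvg_big => [|i _]; first exact: add_continuous.
by apply: cvgM; [exact: cvg_coordinate|apply: cvg_smooth0;
  exact: smooth_on_partial].
Qed.

Lemma dir_dir_coord f v w z : smooth0 f -> z != 0 ->
  dir v (dir w f) z = \sum_i w 0 i * dir v (partial i f) z.
Proof.
move=> sf z1; have sp i : smooth0 (fun y => w 0 i * partial i f y).
  by apply: (smooth_onM op (@smooth_on_cst R n _ _)); exact: smooth_on_partial.
rewrite (dir_ext v z1 (g := fun y => \sum_i w 0 i * partial i f y)).
  rewrite (dir_sum op _ v sp z1); apply: eq_bigr => i _.
  exact: (dirZ op _ _ (smooth_on_partial i sf) z1).
by [].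
Qed.

Lemma near_Z_neq0 : \forall t \near F, Z t != 0.
Proof. by near=> t; near: t; exact: cvgr_neq0 cZ z0_neq0. Unshelve. all: by
  end_near. Qed.

Lemma cvg_dir2 f W1 w1 W2 w2 : smooth0 f ->
  W1 t @[t --> F] --> w1 -> W2 t @[t --> F] --> w2 ->
  dir (W1 t) (dir (W2 t) f) (Z t) @[t --> F] --> dir w1 (dir w2 f) z0.
Proof.
move=> sf c1 c2; rewrite (dir_dir_coord _ _ sf z0_neq0).
have E : \sum_i W2 t 0 i * dir (W1 t) (partial i f) (Z t) @[t --> F]
    --> \sum_i w2 0 i * dir w1 (partial i f) z0.
  apply: cvg_big => [|i _]; first exact: add_continuous.
  apply: cvgM; first exact: cvg_coordinate.
  by apply: (cvg_dir _ c1); exact: smooth_on_partial.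
apply: cvg_trans E; apply: near_eq_cvg; near=> t.
apply/esym/dir_dir_coord => //; near: t; exact: near_Z_neq0.
Unshelve. all: by end_near. Qed.

Lemma cvg_dir3 f W1 w1 W2 w2 W3 w3 : smooth0 f ->
  W1 t @[t --> F] --> w1 -> W2 t @[t --> F] --> w2 -> W3 t @[t --> F] --> w3 ->
  dir (W1 t) (dir (W2 t) (dir (W3 t) f)) (Z t) @[t --> F]
    --> dir w1 (dir w2 (dir w3 f)) z0.
Proof.
move=> sf c1 c2 c3.
have D3 u v w z : z != 0 -> dir u (dir v (dir w f)) z
    = \sum_i w 0 i * dir u (dir v (partial i f)) z.
  move=> z1; have sp i := smooth0_dir v (smooth_on_partial i sf).
  have cp i := smooth_onM op (@smooth_on_cst R n _ (w 0 i)) (sp i).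
  rewrite (dir_ext u z1 (g := fun y => \sum_i w 0 i * dir v (partial i f) y)).
    rewrite (dir_sum op _ u cp z1); apply: eq_bigr => i _.
    exact: (dirZ op _ _ (sp i) z1).
  by move=> y y0; exact: dir_dir_coord.
rewrite (D3 _ _ _ _ z0_neq0).
have E : \sum_i W3 t 0 i * dir (W1 t) (dir (W2 t) (partial i f)) (Z t) @[t -->
  F]
    --> \sum_i w3 0 i * dir w1 (dir w2 (partial i f)) z0.
  apply: cvg_big => [|i _]; first exact: add_continuous.
  apply: cvgM; first exact: cvg_coordinate.
  by apply: (cvg_dir2 _ c1 c2); exact: smooth_on_partial.
apply: cvg_trans E; apply: near_eq_cvg; near=> t.
apply/esym/D3; near: t; exact: near_Z_neq0.
Unshelve. all: by end_near. Qed.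

Variables psi phi : 'rV[R]_n -> R.
Hypothesis phiP : pseudo_norm phi.
Hypothesis phi_smooth : smooth0 phi.
Hypothesis psi_smooth : smooth0 psi.
Hypothesis x0_Omega : Omega phi x0.

Lemma cvg_denV : (den phi (X t) (Z t))^-1 @[t --> F] --> (den phi x0 z0)^-1.
Proof.
have d0 : den phi x0 z0 != 0 by rewrite gt_eqF// (den_gt0 phiP).
apply: cvgV d0 _; apply: cvgB; first exact: cvg_cst.
exact: cvg_dir.
Qed.

(** Stated along an arbitrary filter: [open_Oset] uses product neighbourhoods, [formxi_closure_ge0]
    lets only [x] vary. *)
Lemma formxi_cvg : formxi psi phi (X t) (Z t) (V t) @[t --> F]
  --> formxi psi phi x0 z0 V0.
Proof.
have cb := cvg_denV.
have cb2 := @cvg_expr _ _ 2 cb; have cb3 := @cvg_expr _ _ 3 cb.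
have cp := cvg_smooth0 psi_smooth.
have cpV := cvg_dir psi_smooth cV; have cpX := cvg_dir psi_smooth cX.
have cpVV := cvg_dir2 psi_smooth cV cV.
have cVX := cvg_dir2 phi_smooth cV cX; have cXX := cvg_dir2 phi_smooth cX cX.
have cVV := cvg_dir2 phi_smooth cV cV.
have cVVX := cvg_dir3 phi_smooth cV cV cX.
have c2 : (2 : R) @[t --> F] --> (2 : R) by exact: cvg_cst.
have ch : hfun psi phi (X t) (Z t) @[t --> F] --> hfun psi phi x0 z0 by exact:
  cvgM cp cb.
have ch1 : hfun1 psi phi (X t) (V t) (Z t) @[t --> F] -->
  hfun1 psi phi x0 V0 z0.
  exact: cvgD (cvgM cpV cb) (cvgM cp (cvgM cb2 cVX)).
have cg : gform psi phi (X t) (V t) (Z t) @[t --> F] --> gform psi phi x0 V0 z0.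
  apply: cvgD.
    apply: cvgD.
      by apply: cvgD; [exact: cvgM cpVV cb|exact: cvgM (cvgM (cvgM c2 cpV) cb2)
        cVX].
    apply: cvgM cp _; apply: cvgD.
      exact: cvgM (cvgM c2 cb3) (@cvg_expr _ _ 2 cVX).
    exact: cvgM cb2 cVVX.
  apply: cvgM (cvgM cVV cb) _; apply: cvgD; first exact: cvgM cpX cb.
  exact: cvgM (cvgM cp cb2) cXX.
exact: cvgD (@cvg_expr _ _ 2 ch1) (cvgM ch cg).
Qed.

End JointContinuity.

(** * Compactness of the unit sphere *)

Section Compactness.
Variables (R : realType) (n : nat).

Definition unit_sphere : set 'rV[R]_n := [set v | `|v| = 1].

End Compactness.
Arguments unit_sphere {R n}.

Section Compactness.
Variables (R : realType) (n : nat).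

Lemma compact_unit_sphere : compact (@unit_sphere R n).
Proof.
apply: bounded_closed_compact.
  exists 1; split; first exact: num_real.
  by move=> M M1 v /= ->; exact: ltW.
have -> : @unit_sphere R n = (fun v : 'rV[R]_n => `|v|) @^-1` [set 1 : R] by [].
apply: closed_comp; last exact: closed_eq.
by move=> v _; exact: norm_continuous.
Qed.

Lemma unit_sphere_neq0 (v : 'rV[R]_n) : unit_sphere v -> v != 0.
Proof. by move=> v1; rewrite -normr_eq0 v1 oner_eq0. Qed.

Lemma unit_sphere_normalize (v : 'rV[R]_n) : v != 0 ->
  unit_sphere (`|v|^-1 *: v).
Proof.
by move=> v0; rewrite /unit_sphere /= normrZ normfV normr_id mulVf// normr_eq0.
Qed.

End Compactness.

(** * Connected components of open sets *)

Section Components.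
Variables (R : realType) (n : nat).
Implicit Types (A U : set 'rV[R]_n) (x y : 'rV[R]_n).

Lemma ball_connected_component A x r y : ball x r `<=` A -> ball x r y ->
  connected_component A x y.
Proof.
move=> xA xy; pose g (t : R) := x + t *: (y - x).
exists (g @` `[0, 1]); last first.
  exists 1; first by rewrite /= in_itv /= ler01 lexx.
  by rewrite /g scale1r addrC subrK.
split.
- by exists 0; [rewrite /= in_itv /= ler01 lexx|rewrite /g scale0r addr0].
- move=> _ [t /= + <-]; rewrite in_itv /= => /andP[t0 t1]; apply: xA.
  move: xy; rewrite -!ball_normE /= /g opprD addrA subrr add0r normrN normrZ.
  rewrite distrC; apply: le_lt_trans; rewrite ger0_norm//.
  by rewrite ler_piMl.
- apply: connected_continuous_connected; first exact: segment_connected.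
  apply: continuous_subspaceT => t; rewrite /g.
  have c1 : s *: (y - x) @[s --> t] --> t *: (y - x).
    by apply: cvgZr_tmp; exact: cvg_id.
  exact: cvgD (cvg_cst x) c1.
Qed.

Lemma open_component A U : open A -> is_component U A -> open U.
Proof.
move=> oA [a Aa ->]; rewrite openE => x xU.
have Ax := connected_component_sub xU.
have /nbhs_ballP[r /= r0 rA] : nbhs x A by exact: open_nbhs_nbhs.
apply/nbhs_ballP; exists r => //= y xy.
exact: connected_component_trans xU (ball_connected_component rA xy).
Qed.

(** Were [x] in [A], a ball around it inside [A] would meet [U], hence [x] would belong to the
    component [U], which is open. *)
Lemma component_boundary A U x : open A -> is_component U A -> boundary U x ->
  ~ A x.
Proof.
move=> oA cU [xU nxU] Ax; apply: nxU.
have oU := open_component oA cU; case: cU => a Aa UE.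
suff Ux : U x by move: oU; rewrite openE; exact.
have /nbhs_ballP[r /= r0 rA] : nbhs x A by exact: open_nbhs_nbhs.
have [y [Uy xy]] := xU _ (nbhsx_ballx x r r0).
rewrite UE; rewrite UE in Uy; apply: connected_component_trans Uy _.
exact/connected_component_sym/(ball_connected_component rA xy).
Qed.

End Components.

Section OsetTopology.
Variables (R : realType) (n : nat) (psi phi : 'rV[R]_n -> R).
Hypothesis phiP : pseudo_norm phi.
Hypothesis phi_smooth : smooth0 phi.
Hypothesis psiP : pseudo_norm psi.
Hypothesis psi_smooth : smooth0 psi.
Implicit Types (x y z V : 'rV[R]_n).

Local Notation O := (Oset psi phi).

Lemma open_Omega : open (Omega phi).
Proof.
have -> : Omega phi = phi @^-1` [set t | t < 1] by [].
by apply: open_comp; [move=> x _; exact: pseudo_norm_continuous|exact: open_lt].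
Qed.

Lemma Oset_sphereP x : Omega phi x -> O x <->
  forall z V, unit_sphere z -> unit_sphere V -> 0 < formxi psi phi x z V.
Proof.
move=> x1; have H := Oset_formxiP phiP phi_smooth psiP psi_smooth x1.
split=> [/H Ox z V /unit_sphere_neq0 z0 /unit_sphere_neq0 V0|H1].
  exact: Ox.
apply/H => z V z0 V0.
have nz : 0 < `|z|^-1 by rewrite invr_gt0 normr_gt0.
have nV : 0 < `|V|^-1 by rewrite invr_gt0 normr_gt0.
have := H1 _ _ (unit_sphere_normalize z0) (unit_sphere_normalize V0).
rewrite (formxi_scale phiP phi_smooth psiP psi_smooth _ _ nz z0).
rewrite (formxi_scaleV phi_smooth psi_smooth _ _ _ z0).
by rewrite pmulr_rgt0// exprn_gt0.
Qed.

Lemma open_Oset : open O.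
Proof.
rewrite openE => x0 Ox0; have x1 := Ox0.1.
have K := compact_setX (@compact_unit_sphere R n) (@compact_unit_sphere R n).
have H := (Oset_sphereP x1).1 Ox0.
(* Tube lemma: the neighbourhoods of [x0] found near each pair on the compact product merge into a
   single one. *)
have /compact_near_coveringP nK := K.
have nO := nK _ (nbhs x0) (fun x p => 0 < formxi psi phi x p.1 p.2) _.
have near1 : \forall x \near x0, unit_sphere `*` unit_sphere `<=`
    (fun p => 0 < formxi psi phi x p.1 p.2).
  apply: nO => -[z V] [/= z1 V1].
  have cx : p.2 @[p --> ((z, V), x0)] --> x0 by exact: cvg_snd.
  have cz : p.1.1 @[p --> ((z, V), x0)] --> z.
    exact: (cvg_comp _ _ cvg_fst cvg_fst).
  have cV : p.1.2 @[p --> ((z, V), x0)] --> V.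
    exact: (cvg_comp _ _ cvg_fst cvg_snd).
  have c := formxi_cvg cx cz cV (unit_sphere_neq0 z1) phiP phi_smooth
    psi_smooth x1.
  exact: (cvgr_gt _ (c (nbhs_filter _)) _ (H _ _ z1 V1)).
rewrite /interior; near=> x.
apply/Oset_sphereP.
  by near: x; apply: open_nbhs_nbhs; split; [exact: open_Omega|].
have Hx : unit_sphere `*` unit_sphere `<=` (fun p =>
  0 < formxi psi phi x p.1 p.2).
  by near: x.
by move=> z V z1 V1; exact: (Hx (z, V) (conj z1 V1)).
Unshelve. all: by end_near. Qed.

Lemma formxi_closure_ge0 x z V : closure O x -> Omega phi x -> z != 0 ->
  V != 0 ->
  0 <= formxi psi phi x z V.
Proof.
move=> cx x1 z0 V0; rewrite leNgt; apply/negP => neg.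
have c : formxi psi phi y z V @[y --> x] --> formxi psi phi x z V.
  exact: (@formxi_cvg R n _ (nbhs x) _ id (fun=> z) (fun=> V) x z V cvg_id
    (cvg_cst z) (cvg_cst V) z0 psi phi phiP phi_smooth psi_smooth x1).
have nneg : \forall y \near x, formxi psi phi y z V < 0.
  exact: (cvgr_lt _ c _ neg).
have [y [Oy yneg]] := cx _ nneg.
have := (Oset_formxiP phiP phi_smooth psiP psi_smooth Oy.1).1 Oy z V z0 V0.
by rewrite ltNge (ltW yneg).
Qed.

End OsetTopology.

(** * Separation of a line from an open convex set *)

Section Separation.
Variables (R : realType) (n : nat).
Implicit Types (C U : set 'rV[R]_n) (x y u v w c p nu : 'rV[R]_n).

(** The ambient sup norm has no inner product; nearest points are taken for the Euclidean one. *)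
Definition dot u v : R := \sum_i u 0 i * v 0 i.

Lemma dotC u v : dot u v = dot v u.
Proof. by apply: eq_bigr => i _; rewrite mulrC. Qed.

Lemma dotDr u v w : dot u (v + w) = dot u v + dot u w.
Proof. by rewrite /dot -big_split; apply: eq_bigr => i _;
  rewrite mxE mulrDr. Qed.

Lemma dotZr (a : R) u v : dot u (a *: v) = a * dot u v.
Proof. by rewrite /dot mulr_sumr; apply: eq_bigr => i _;
  rewrite mxE mulrCA. Qed.

Lemma dotNr u v : dot u (- v) = - dot u v.
Proof. by rewrite -scaleN1r dotZr mulN1r. Qed.

Lemma dotBr u v w : dot u (v - w) = dot u v - dot u w.
Proof. by rewrite dotDr dotNr. Qed.

Lemma dotDl u v w : dot (v + w) u = dot v u + dot w u.
Proof. by rewrite !(dotC _ u) dotDr. Qed.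

Lemma dotZl (a : R) u v : dot (a *: v) u = a * dot v u.
Proof. by rewrite !(dotC _ u) dotZr. Qed.

Lemma dot_ge0 u : 0 <= dot u u.
Proof. by apply: sumr_ge0 => i _; rewrite -expr2 sqr_ge0. Qed.

Lemma coord_sqr_le_dot u j : u 0 j ^+ 2 <= dot u u.
Proof.
rewrite /dot (bigD1 j)//= -expr2 lerDl.
by apply: sumr_ge0 => i _; rewrite -expr2 sqr_ge0.
Qed.

Lemma cvg_dot (T : Type) (F : set_system T) (FF : Filter F) (f g : T ->
  'rV[R]_n) u v :
  f t @[t --> F] --> u -> g t @[t --> F] --> v ->
  dot (f t) (g t) @[t --> F] --> dot u v.
Proof.
move=> fu gv; rewrite /dot; apply: cvg_big => [|i _];
  first exact: add_continuous.
by apply: cvgM; exact: cvg_coordinate.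
Qed.

Definition segment_convex C :=
  forall a b (s : R), C a -> C b -> 0 <= s <= 1 -> C (a + s *: (b - a)).

Lemma segment_convex_closure C a b (s : R) : segment_convex C ->
  closure C a -> C b -> 0 <= s <= 1 -> closure C (a + s *: (b - a)).
Proof.
move=> cC aC Cb s01 B nB.
have cg : (w + s *: (b - w)) @[w --> a] --> a + s *: (b - a).
  have c1 : (b - w) @[w --> a] --> b - a by exact (cvgB (cvg_cst b) (@cvg_id _
    (nbhs a))).
  have c2 : s *: (b - w) @[w --> a] --> s *: (b - a) by exact: cvgZl_tmp c1.
  have c3 : w @[w --> a] --> a := @cvg_id _ (nbhs a).
  exact (cvgD c3 c2).
have [w [Cw Bw]] := aC _ (cg _ nB).
by exists (w + s *: (b - w)); split=> //; exact: cC.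
Qed.

Lemma nearest_point C p c1 : C c1 ->
  exists2 m, closure C m & forall w, closure C w ->
    dot (m - p) (m - p) <= dot (w - p) (w - p).
Proof.
move=> Cc1; pose q w := dot (w - p) (w - p).
have cq : continuous q.
  move=> w; have c1' : (v - p) @[v --> w] --> w - p.
    exact (cvgB (@cvg_id _ (nbhs w)) (cvg_cst p)).
  exact (cvg_dot _ c1' c1').
pose K := closure C `&` [set w | q w <= q c1].
have Kc : compact K.
  apply: bounded_closed_compact; last first.
    apply: closedI; first exact: closed_closure.
    have -> : [set w | q w <= q c1] = q @^-1` [set t | t <= q c1] by [].
    by apply: closed_comp; [move=> w _; exact: cq|exact: closed_le].
  (* Each coordinate [t] of [w - p] satisfies [t^2 <= q c1], and [|t| <= t^2 + 1]. *)
  exists (q c1 + 1 + `|p|); split; first exact: num_real.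
  move=> M /ltW MM w [_ /= qw]; apply: le_trans MM.
  rewrite -[w](subrK p); apply: le_trans (ler_normD _ _) _; rewrite lerD2r.
  apply: norm_row_le => [|j]; first by rewrite addr_ge0// dot_ge0.
  have := le_trans (coord_sqr_le_dot (w - p) j) qw.
  move: ((w - p) 0 j) (q c1) => t b; rewrite expr2 => tt.
  by rewrite ler_norml; apply/andP; split; nra.
have K0 : K !=set0 by exists c1; split; [exact: subset_closure|exact: lexx].
have [m mK mmin] := EVT_min_rV K0 Kc (continuous_subspaceT cq).
move: mK; rewrite inE => -[Cm qm]; exists m => // w Cw.
have [wc|cw] := leP (q w) (q c1); first by apply: mmin; rewrite inE.
exact: le_trans qm (ltW cw).
Qed.

(** The covector points from the nearest point [m] to [p]. If some [c] made a positive product with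
    it, moving from [m] slightly towards [c] would come closer to [p]. *)
Lemma separate_closure C p c1 : segment_convex C -> C c1 -> ~ closure C p ->
  exists2 nu, nu != 0 & forall c, C c -> dot nu (c - p) <= 0.
Proof.
move=> cC Cc1 Cp; have [m Cm mmin] := nearest_point p Cc1.
exists (p - m).
  by rewrite subr_eq0; apply/eqP => pm; apply: Cp; rewrite pm.
move=> c Cc.
have -> : c - p = (c - m) - (p - m) by rewrite opprB addrA subrK.
rewrite dotBr; suff : dot (p - m) (c - m) <= 0.
  have := dot_ge0 (p - m); lra.
rewrite leNgt; apply/negP => d0.
set d := dot _ _ in d0; set e := dot (c - m) (c - m).
have e0 : 0 <= e by exact: dot_ge0.
(* The squared distance changes by [s^2 e - 2 s d], which is negative because [s * e < d]; moreover
   [s <= 1]. *)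
pose s := d / (d + e + 1).
have D0 : 0 < d + e + 1 by lra.
have s0 : 0 < s by rewrite divr_gt0.
have s1 : s <= 1 by rewrite ler_pdivrMr// mul1r; lra.
have s01 : 0 <= s <= 1 by rewrite (ltW s0) s1.
have := mmin _ (segment_convex_closure cC Cm Cc s01).
have Q h v : dot (s *: h + (-1) *: v) (s *: h + (-1) *: v)
    = s * s * dot h h - 2 * s * dot v h + dot v v.
  by rewrite !(dotDl, dotDr, dotZl, dotZr) (dotC h v); ring.
have -> : m + s *: (c - m) - p = s *: (c - m) + (-1) *: (p - m).
  by apply/rowP => i; rewrite !mxE; ring.
have -> : m - p = (-1) *: (p - m) by rewrite scaleN1r opprB.
rewrite Q dotZl dotZr -/d -/e.
have sE : s * (d + e + 1) = d by rewrite divfK// gt_eqF.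
by move: (dot (p - m) (p - m)) => k; nra.
Qed.

(* Were every covector positive somewhere on C, compactness of the unit sphere
   would make this persist after a small translation of C; but the points
   [- e *: c0] close to 0 lie outside the closure of C, hence are separated. *)
Lemma separate_open C c0 : open C -> segment_convex C -> C c0 -> ~ C 0 ->
  exists2 nu, nu != 0 & forall c, C c -> dot nu c <= 0.
Proof.
move=> oC cC Cc0 C0.
(* Otherwise some [w] in [C] close to [- e *: c0] has [- e^-1 *: w] close to [c0], thus in [C]; the
   origin lies between these two points. *)
have nclos (e : R) : 0 < e -> ~ closure C (- (e *: c0)).
  move=> e0 cp; apply: C0.
  have cg : (- e^-1) *: w @[w --> - (e *: c0)] --> c0.
    have E : (- e^-1) *: (- (e *: c0)) = c0.
      by rewrite scaleNr scalerN opprK scalerA mulVf ?scale1r// gt_eqF.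
    have cE : (- e^-1) *: w @[w --> - (e *: c0)] --> (- e^-1) *: (- (e *: c0)).
      exact (cvgZl_tmp (@cvg_id _ (nbhs (- (e *: c0))))).
    by rewrite E in cE.
  have nC : nbhs c0 C by exact: open_nbhs_nbhs.
  have [w [Cw /= Cw']] := cp _ (cg _ nC).
  have e1 : 0 < 1 + e by lra.
  have -> : 0 = w + (e / (1 + e))%R *: ((- e^-1) *: w - w) :> 'rV[R]_n.
    rewrite -{3}[w]scale1r -scalerBl scalerA -{1}[w]scale1r -scalerDl.
    rewrite (_ : _ + _ = 0) ?scale0r//.
    by field; rewrite !gt_eqF.
  apply: cC => //; rewrite divr_ge0 ?(ltW e0) ?(ltW e1)//=.
  by rewrite ler_pdivrMr// mul1r; lra.
apply: contrapT => H.
have H1 nu : unit_sphere nu -> exists2 c, C c & 0 < dot nu c.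
  move=> nu1; apply: contrapT => H2; apply: H; exists nu;
    first exact: unit_sphere_neq0.
  move=> c Cc; rewrite leNgt; apply/negP => pos; apply: H2; by exists c.
have /compact_near_coveringP nK := @compact_unit_sphere R n.
have nO := nK _ (nbhs (0 : 'rV[R]_n))
  (fun p nu => exists2 c, C c & 0 < dot nu (c - p)) _.
have near1 : \forall p \near (0 : 'rV[R]_n), @unit_sphere R n `<=`
    (fun nu => exists2 c, C c & 0 < dot nu (c - p)).
  apply: nO => nu /H1[c Cc cpos].
  have cf : t.1 @[t --> (nu, (0 : 'rV[R]_n))] --> nu by exact: cvg_fst.
  have cs : t.2 @[t --> (nu, (0 : 'rV[R]_n))] --> (0 : 'rV[R]_n) by exact:
    cvg_snd.
  have cc : c @[_ --> (nu, (0 : 'rV[R]_n))] --> c by exact: cvg_cst.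
  have c1 : dot t.1 (c - t.2) @[t --> (nu, (0 : 'rV[R]_n))] --> dot nu (c - 0).
    by exact (cvg_dot (nbhs_filter _) cf (cvgB cc cs)).
  rewrite subr0 in c1.
  have c2 : \forall t \near (nu, (0 : 'rV[R]_n)), 0 < dot t.1 (c - t.2).
    exact: (cvgr_gt _ c1 _ cpos).
  by apply: filterS c2 => t tpos; exists c.
have cp : - (e *: c0) @[e --> (0 : R)] --> - (0 *: c0).
  exact (cvgN (@cvgZr_tmp _ _ _ (nbhs (0 : R)) _ _ _ c0 (@cvg_id _ (nbhs (0 :
    R))))).
rewrite scale0r oppr0 in cp.
have /nbhs_ballP[r /= r0 Hr] := cp _ near1.
have r2 : 0 < r / 2 by rewrite divr_gt0.
have br : ball (0 : R) r (r / 2).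
  by rewrite -ball_normE /= sub0r normrN gtr0_norm//; lra.
have [nu nu0 nuC] := separate_closure cC Cc0 (nclos _ r2).
have [c Cc] := Hr _ br _ (unit_sphere_normalize nu0).
rewrite dotZl pmulr_rgt0 ?invr_gt0 ?normr_gt0// => pos.
by have := nuC _ Cc; rewrite leNgt pos.
Qed.

Lemma convex_set_segment U : convex_set U -> segment_convex U.
Proof.
move=> cU a b s Ua Ub /andP[s0 s1].
have := cU b a (Itv01 s0 s1); rewrite !inE => /(_ Ub Ua).
rewrite /conv /= => Us.
have -> : a + s *: (b - a) = s *: b + (1 - s) *: a.
  by apply/rowP => i; rewrite !mxE; ring.
exact: Us.
Qed.

Lemma line_meets_open_convex U x y u0 : open U -> convex_set U -> U u0 ->
  ~ tangent U x y -> exists t : R, U (x + t *: y).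
Proof.
move=> oU /convex_set_segment cU Uu0 xy; apply: contrapT => H; apply: xy.
(* The translate of [U] by [- x], thickened along [y]: it contains 0 exactly when the line meets
   [U], and it is invariant under translation by [y]. *)
pose C := [set c | exists2 s : R, True & U (x + s *: y + c)].
have oC : open C.
  rewrite openE => c [s _ Us]; rewrite /interior.
  have cg : x + s *: y + w @[w --> c] --> x + s *: y + c.
    exact (cvgD (cvg_cst _) (@cvg_id _ (nbhs c))).
  have nU : nbhs (x + s *: y + c) U by exact: open_nbhs_nbhs.
  by apply: (@filterS _ (nbhs c) _ _ _ _ (cg _ nU)) => w Uw; exists s.
have cC : segment_convex C.
  move=> a b r [s _ Us] [t _ Ut] r01; exists (s + r * (t - s)) => //.
  have := cU _ _ _ Us Ut r01; congr (U _).
  by apply/rowP => i; rewrite !mxE; ring.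
have C0 : ~ C 0 by move=> [s _]; rewrite addr0 => Us; apply: H; exists s.
have Cu u (s : R) : U u -> C (u - x + s *: y).
  move=> Uu; exists (- s) => //; rewrite (_ : _ + _ = u)//.
  by apply/rowP => i; rewrite !mxE; ring.
have [nu nu0 nuC] := separate_open oC cC (Cu _ 0 Uu0) C0.
have nuy : dot nu y = 0.
  apply: contrapT => /eqP ny.
  (* This multiple of [y] brings the value of [nu] to 1, against the bound by 0. *)
  have := nuC _ (Cu u0 ((1 - dot nu (u0 - x)) / dot nu y) Uu0).
  by rewrite dotDr dotZr divfK//; lra.
exists [set v | dot nu v = 0] => //; exists nu; split=> // u Uu.
have := nuC _ (Cu _ 0 Uu); rewrite scale0r addr0; congr (_ <= 0).
by apply: eq_bigr => i _; rewrite !mxE.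
Qed.

End Separation.

(** * Boundary points *)

Section SemidefiniteKernel.
Variables (R : realType) (n : nat) (A : 'M[R]_n).
Hypothesis A_sym : forall i j, A i j = A j i.
Implicit Types (u v w : 'rV[R]_n).

Lemma dot_mulmx u v : dot (u *m A) v = \sum_i \sum_j A i j * u 0 i * v 0 j.
Proof.
rewrite /dot exchange_big; apply: eq_bigr => j _ /=.
by rewrite mxE mulr_suml; apply: eq_bigr => i _; rewrite [A i j * _]mulrC.
Qed.

Lemma dot_mulmx_sym u v : dot (u *m A) v = dot (v *m A) u.
Proof.
rewrite !dot_mulmx exchange_big; apply: eq_bigr => j _; apply: eq_bigr =>
  i _ /=.
by rewrite A_sym mulrAC.
Qed.

(** For every [w] the polynomial [2 s b + s^2 q], the form at [v + s w], is nonnegative, which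
    forces its linear coefficient to vanish. *)
Lemma semidefinite_kernel v : (forall w, 0 <= dot (w *m A) w) ->
  dot (v *m A) v = 0 -> v *m A = 0.
Proof.
move=> A0 v0; have B w : dot (v *m A) w = 0.
  set b := dot _ _; set q := dot (w *m A) w.
  have q0 : 0 <= q by exact: A0.
  have H (s : R) : 0 <= 2 * s * b + s * s * q.
    have := A0 (v + s *: w); rewrite mulmxDl -scalemxAl !(dotDl, dotDr, dotZl,
      dotZr).
    rewrite v0 (dot_mulmx_sym w v) -/b -/q; lra.
  have q1 : 0 < q + 1 by lra.
  (* The value here is [- b^2 (q + 2) / (q + 1)^2]; dividing by [q + 1] allows [q = 0]. *)
  have := H (- b / (q + 1)).
  have -> : 2 * (- b / (q + 1)) * b + - b / (q + 1) * (- b / (q + 1)) * q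
      = - (b ^+ 2 * (q + 2) / (q + 1) ^+ 2) by field; rewrite gt_eqF.
  rewrite oppr_ge0 => le0; apply/eqP; rewrite -sqrf_eq0 eq_le sqr_ge0 andbT.
  rewrite leNgt; apply/negP => b0; move: le0; rewrite leNgt; apply/negP/negPn.
  by rewrite divr_gt0 ?exprn_gt0// mulr_gt0//; lra.
apply/rowP => j; rewrite [RHS]mxE; apply/eqP; rewrite -sqrf_eq0 eq_le sqr_ge0
  andbT.
by apply: le_trans (coord_sqr_le_dot _ _) _; rewrite B.
Qed.

End SemidefiniteKernel.

Lemma hessian_sym (R : realType) (n : nat) (f : 'rV[R]_n -> R) y i j :
  smooth0 f -> y != 0 -> hessian f y i j = hessian f y j i.
Proof.
move=> sf y0; rewrite !mxE -!(dir_delta _ _ y).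
have E k l : dir (delta_mx 0 k) (partial l f) y
    = dir (delta_mx 0 k) (dir (delta_mx 0 l) f) y.
  by apply: (dir_ext _ y0) => z _; rewrite dir_delta.
rewrite (E j i) (E i j).
exact: (dir_comm (@open_neq0 R n) (delta_mx 0 j) (delta_mx 0 i) sf y0).
Qed.

(** * Tangent and parallel directions *)

Section Tangency.
Variables (R : realType) (n : nat).
Implicit Types (U : set 'rV[R]_n) (x y : 'rV[R]_n).

Lemma tangent0 U x : smooth_boundary_point U x -> tangent U x 0.
Proof.
move=> [_ [H [HH _]]]; exists H => //; case: HH => nu [_ _ ->] /=.
by rewrite big1// => i _; rewrite mxE mulr0.
Qed.

Lemma not_tangent_neq0 U x y : smooth_boundary_point U x -> ~ tangent U x y ->
  y != 0.
Proof. by move=> sx xy; apply/eqP => y0; apply: xy; rewrite y0;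
  exact: tangent0. Qed.

(** Uniqueness of the supporting direction puts both tangent vectors into one linear hyperplane, so
    their difference [t x] would lie in it too. *)
Lemma not_tangentD U x y (t : R) : smooth_boundary_point U x -> tangent U x y ->
  ~ tangent U x x -> t != 0 -> ~ tangent U x (y + t *: x).
Proof.
move=> [_ [H [_ Huniq]]] [H1 S1 H1y] xx t0 [H2 S2 H2y]; apply: xx.
move: H1y H2y; rewrite -(Huniq _ S1) -(Huniq _ S2) => Hy Hyt.
exists H; first by rewrite (Huniq _ S1).
have [nu [_ _ HE]] : supporting_direction U x H by rewrite (Huniq _ S1).
move: Hy Hyt; rewrite HE /=.
rewrite -![\sum_i _]/(dot nu _) dotDr dotZr => -> /eqP.
by rewrite add0r mulf_eq0 (negbTE t0) /= => /eqP.
Qed.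

(** There is at most one exceptional [t0], and it is nonzero. For a second one [t], the combination
    [t (y + t0 x) - t0 (y + t x) = (t - t0) y] would make [y] parallel to [v]. *)
Lemma near_not_parallel x y v : y != 0 -> v != 0 -> ~ parallel y v ->
  \forall t \near (0 : R)^', ~ parallel (y + t *: x) v.
Proof.
move=> y0 v0 yv.
have inv (t : R) : parallel (y + t *: x) v -> exists d : R, y + t *: x = d *: v.
  move=> [c vE]; exists c^-1; rewrite vE scalerA mulVf ?scale1r//.
  by apply: contraNneq v0 => c0; rewrite vE c0 scale0r.
have [[t0 par0]|nopar] := pselect (exists t : R, parallel (y + t *: x) v);
  last first.
  by near=> t => par; apply: nopar; exists t.
have t0n : t0 != 0.
  by apply/eqP => t00; apply: yv; move: par0; rewrite t00 scale0r addr0.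
have near1 : \forall t \near (0 : R)^', `|t| < `|t0|.
  by apply: dnbhs0_lt; rewrite normr_gt0.
near=> t => par; have tt : `|t| < `|t0| by near: t.
have tn : t - t0 != 0 by rewrite subr_eq0; apply: contraTneq tt => ->;
  rewrite ltxx.
have [d0 E0] := inv _ par0; have [d E] := inv _ par.
have yE : (t - t0) *: y = (t * d0 - t0 * d) *: v.
  rewrite [RHS]scalerBl -!scalerA -E0 -E.
  by apply/rowP => i; rewrite !mxE; ring.
apply: yv; have k0 : t * d0 - t0 * d != 0.
  apply/eqP => k0; move/eqP: yE; rewrite k0 scale0r scaler_eq0 (negbTE tn) /=.
  by rewrite (negbTE y0).
exists ((t * d0 - t0 * d)^-1 * (t - t0)).
by rewrite -scalerA yE scalerA mulVf// scale1r.
Unshelve. all: by end_near. Qed.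

End Tangency.

(** * Definiteness and degeneracy of the Hessian on the boundary of [U] *)

Section Boundary.
Variables (R : realType) (n : nat) (psi phi : 'rV[R]_n -> R).
Hypothesis phiP : pseudo_norm phi.
Hypothesis phi_smooth : smooth0 phi.
Hypothesis psiP : pseudo_norm psi.
Hypothesis psi_smooth : smooth0 psi.
Variable U : set 'rV[R]_n.
Hypothesis U_component : is_component U (Oset psi phi).
Hypothesis U_convex : convex_set U.
Implicit Types (x y v w theta : 'rV[R]_n).

Local Notation F := (Fmetric psi phi).

Let U_sub : U `<=` Oset psi phi.
Proof. by case: U_component => a _ -> ; exact: connected_component_sub. Qed.

Let open_O : open (Oset psi phi).
Proof. exact: open_Oset. Qed.

Lemma posdef_not_tangent x y : smooth_boundary_point U x -> Omega phi x ->
  ~ tangent U x y -> posdef (hessian (fun z => F x z ^+ 2) y).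
Proof.
move=> sx x1 xy; have y0 := not_tangent_neq0 sx xy.
have [a Ua] : exists a, U a.
  case: U_component => a Oa ->; exists a; exact: connected_component_refl.
have [t Ut] := line_meets_open_convex (open_component open_O U_component)
  U_convex Ua xy.
have [xt1 mF] := U_sub Ut.
apply/(posdef_FmetricP phiP phi_smooth psiP psi_smooth x1 y0) => v yv.
rewrite -(dir2_Fmetric_line phiP phi_smooth psiP psi_smooth y0 x1 xt1 v).
by apply: (posdef_FmetricP phiP phi_smooth psiP psi_smooth xt1 y0).1 => //;
  exact: mk_posdef.
Qed.

Lemma hessian_boundary_ge0 x y w : boundary U x -> Omega phi x -> y != 0 ->
  0 <= dot (w *m hessian (fun z => F x z ^+ 2) y) w.
Proof.
move=> [cx _] x1 y0.
have [->|w0] := eqVneq w 0.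
  by rewrite /dot big1// => i _; rewrite [X in _ * X]mxE mulr0.
rewrite dot_mulmx (hessian_formxi phiP phi_smooth psi_smooth x1 _ y0)
  pmulr_rge0//.
apply: (formxi_closure_ge0 phiP phi_smooth psiP psi_smooth) => //.
- by move=> B /cx[z [/U_sub Oz Bz]]; exists z.
- exact: xi_neq0.
- apply: contraNneq w0 => V0.
  by rewrite (vxi_cancel phiP phi_smooth x1 w y0) V0 dir0v scale0r subr0.
Qed.

Lemma boundary_degenerate x : boundary U x -> Omega phi x ->
  exists2 y, y != 0 & ~ posdef (hessian (fun z => F x z ^+ 2) y).
Proof.
move=> bx x1; have nO := component_boundary open_O U_component bx.
apply: contrapT => H; apply: nO; split; first exact: x1.
apply: (elliptic_minkowski (Fmetric_ge0 phiP phi_smooth psiP x1)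
  (Fmetric_eq0 phiP phi_smooth psiP x1) (Fmetric_homo phiP phi_smooth psiP x1)
  (smooth0_Fmetric phiP phi_smooth psi_smooth x1)) => y y0.
by apply: contrapT => ny; apply: H; exists y.
Qed.

Lemma not_posdef_eigenvalue0 x y : boundary U x -> Omega phi x -> y != 0 ->
  ~ posdef (hessian (fun z => F x z ^+ 2) y) ->
  eigenvalue (hessian (fun z => F x z ^+ 2) y) 0.
Proof.
move=> bx x1 y0 npos; have A0 w := @hessian_boundary_ge0 x y w bx x1 y0.
have sF := smooth0_Fmetric phiP phi_smooth psi_smooth x1.
have Asym i j := hessian_sym i j (smooth_sqr sF) y0.
have [v v0 vA] : exists2 v : 'rV[R]_n, v != 0 &
    dot (v *m hessian (fun z => F x z ^+ 2) y) v <= 0.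
  apply: contrapT => H; apply: npos => v v0; rewrite -dot_mulmx ltNge.
  by apply/negP => le0; apply: H; exists v.
apply/eigenvalueP; exists v => //; rewrite scale0r.
apply: (semidefinite_kernel Asym A0); apply/eqP.
by rewrite eq_le vA A0.
Qed.

(** Semidefiniteness gives [F_vv >= 0] for [v = theta], so both terms of [F_v^2 + F F_vv = 0]
    vanish. A multiple [c *: y] would have first derivative [c * F x y], forcing [c = 0]. *)
Lemma null_vector x y theta : boundary U x -> Omega phi x -> y != 0 ->
  theta != 0 ->
  theta *m hessian (fun z => F x z ^+ 2) y = 0 ->
  [/\ ~ parallel y theta, dir theta (F x) y = 0 & dir theta (dir theta (F x)) y
    = 0].
Proof.
move=> bx x1 y0 th0 thA.
have sF := smooth0_Fmetric phiP phi_smooth psi_smooth x1.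
have Fh := Fmetric_homo phiP phi_smooth psiP x1.
have Fy := Fmetric_gt0 phiP phi_smooth psiP x1 y0.
have HE w : dot (w *m hessian (fun z => F x z ^+ 2) y) w
    = 2 * (dir w (F x) y ^+ 2 + F x y * dir w (dir w (F x)) y).
  by rewrite dot_mulmx; exact: hessian_FmetricE.
have Q0 : dir theta (F x) y ^+ 2 + F x y * dir theta (dir theta (F x)) y = 0.
  have := HE theta; rewrite thA /dot big1 => [/esym/eqP|i _];
    last by rewrite mxE mul0r.
  by rewrite mulf_eq0 pnatr_eq0 /= => /eqP.
have pos : 0 <= dir theta (dir theta (F x)) y.
  (* Chosen so that the first derivative along [theta + c *: y] is zero; the nonnegative form then
     isolates the second derivative. *)
  pose c := - (dir theta (F x) y / F x y).
  have := @hessian_boundary_ge0 x y (theta + c *: y) bx x1 y0.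
  rewrite HE (dir2_homo1_comb Fh sF _ _ y0) dirDv dirZv (dir_homo1 Fh sF y0).
  rewrite /c mulNr divfK ?gt_eqF// subrr expr0n add0r.
  by rewrite pmulr_rge0// pmulr_rge0.
have d1 : dir theta (F x) y = 0.
  apply/eqP; rewrite -sqrf_eq0; move/eqP: Q0.
  by rewrite paddr_eq0 ?sqr_ge0 ?(mulr_ge0 (ltW Fy) pos)// => /andP[].
have d2 : dir theta (dir theta (F x)) y = 0.
  move/eqP: Q0; rewrite d1 expr0n add0r mulf_eq0 (gt_eqF Fy) /= => /eqP; exact.
split=> // -[c thE].
move/eqP: d1; rewrite thE dirZv (dir_homo1 Fh sF y0) mulf_eq0 (gt_eqF Fy) orbF.
by move=> /eqP c0; move: th0; rewrite thE c0 scale0r eqxx.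
Qed.

End Boundary.

Theorem proposition3p16 (R : realType) (n : nat) (hn : (2 <= n)%N)
    (psi phi : 'rV[R]_n -> R)
    (hpsi : minkowski_norm psi) (hphi : weak_minkowski_norm phi)
    (U : set 'rV[R]_n)
    (hU : is_component U (Oset psi phi)) (cU : convex_set U) :
  let F := Fmetric psi phi in
  (forall x y : 'rV[R]_n,
      smooth_boundary_point U x -> Omega phi x -> ~ tangent U x y ->
      posdef (hessian (fun z => F x z ^+ 2) y))
  /\
  (forall x : 'rV[R]_n, smooth_boundary_point U x -> Omega phi x ->
    exists y : 'rV[R]_n,
      [/\ y != 0,
          tangent U x y,
          eigenvalue (hessian (fun z => F x z ^+ 2) y) 0 &
          forall theta : 'rV[R]_n, theta != 0 ->
            (theta <= eigenspace (hessian (fun z => F x z ^+ 2) y) 0)%MS ->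
            [/\ ~ (exists c : R, theta = c *: y),
                \sum_i partial i (F x) y * theta 0 i = 0,
                \sum_i \sum_j
                  hessian (F x) y i j * theta 0 i * theta 0 j = 0 &
                ~ tangent U x x ->
                \forall t \near (0 : R)^',
                  0 < \sum_i \sum_j
                        hessian (F x) (y + t *: x) i j
                          * theta 0 i * theta 0 j]]).
Proof.
have psiP := wm_pseudo (mk_weak hpsi); have psi_smooth :=
  wm_smooth (mk_weak hpsi).
have phiP := wm_pseudo hphi; have phi_smooth := wm_smooth hphi.
move=> F; have A x y := @posdef_not_tangent R n psi phi phiP phi_smooth psiP
  psi_smooth U hU cU x y.
split=> [//|x sx x1].
have sF := smooth0_Fmetric phiP phi_smooth psi_smooth x1.
have [y y0 npos] := boundary_degenerate phiP phi_smooth psiP psi_smooth hU sx.1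
  x1.
have ty : tangent U x y by apply: contrapT => nty; apply: npos; exact: A.
exists y; split=> //.
  exact: (not_posdef_eigenvalue0 phiP phi_smooth psiP psi_smooth hU sx.1 x1 y0).
move=> theta th0 /eigenspaceP; rewrite scale0r => thA.
have [np d1 d2] := null_vector phiP phi_smooth psiP psi_smooth hU sx.1 x1 y0
  th0 thA.
split=> //.
- apply: (etrans _ (d1 : \sum_i theta 0 i * partial i (F x) y = 0)).
  by apply: eq_bigr => i _; rewrite mulrC.
- apply: (etrans _ d2).
  exact: (esym (dir2E (@open_neq0 R n) _ _ sF y0)).
(* For [t != 0] the vector [y + t x] is not tangent, so (a) applies to it; small [t] keeps [theta]
   from being parallel to it. *)
move=> nxx; have near1 := near_not_parallel x y0 th0 np.
near=> t; have t0 : t != 0 by near: t; exact: nbhs_dnbhs_neq.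
have nt := not_tangentD sx ty nxx t0.
have yt0 := not_tangent_neq0 sx nt.
rewrite -(dir2E (@open_neq0 R n) _ _ sF yt0).
apply: (posdef_FmetricP phiP phi_smooth psiP psi_smooth x1 yt0).1;
  first exact: A.
by near: t.
Unshelve. all: by end_near. Qed.
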